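(* Let $1<q<\infty$ and let $\Omega\subset\mathbb{R}^3$ be a nonempty open bounded set. Then there exist $P\in L^\infty(\Omega;\mathbb{R}^{3\times 3})$ with $\det P(x)=1$ for a.e. $x\in\Omega$ and a sequence $(u_n)_{n\ge 1}$ in $W_0^{1,q}(\Omega;\mathbb{R}^3)\cap L^\infty(\Omega;\mathbb{R}^3)$ such that: (a) for every $n$, $Du_n(x)P(x)+(Du_n(x)P(x))^T=0$ for a.e. $x\in\Omega$; (b) for every $n$, $\|Du_n\|_q=2^{1/q}$; (c) $\|u_n\|_\infty\to 0$ as $n\to\infty$.
   Context: For $u=(u^1,u^2,u^3)\in W_0^{1,q}(\Omega;\mathbb{R}^3)$, $Du$ denotes the $3\times 3$ matrix-valued weak derivative whose $i$-th row is the gradient of the component $u^i$; $DuP$ denotes the pointwise matrix product. For a measurable matrix field $M:\Omega\to\mathbb{R}^{3\times 3}$ with rows $m_1,m_2,m_3$, the $L^q$-norm is defined by $$\|M\|_q^q=\int_\Omega\left(|m_1(x)|^q+|m_2(x)|^q+|m_3(x)|^q\right)dx,$$ where $|\cdot|$ is the Euclidean norm on $\mathbb{R}^3$. $\|u\|_\infty$ is the essential supremum over $\Omega$ of the Euclidean norm $|u(x)|$. *)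

(* Defs.v *)
From HB Require Import structures.
From mathcomp Require Import all_boot all_order all_algebra.
From mathcomp Require Import all_classical all_reals all_analysis ess_sup_inf.
Set Implicit Arguments.
Unset Strict Implicit.
Unset Printing Implicit Defensive.
Import Order.TTheory GRing.Theory Num.Theory.
Import numFieldNormedType.Exports.
Local Open Scope classical_set_scope.
Local Open Scope ring_scope.

(* Fields on an open subset [Om] of R^3 are total functions
   on R^3 whose values outside [Om] are irrelevant. *)

(* [measurableTypeR R] is [R] with its Borel sigma-algebra, the one that
   [lebesgue_measure] is defined on. Topology and norm on [R3 R] are those of
   the product. *)
Notation R3 R :=
  (measurableTypeR R * measurableTypeR R * measurableTypeR R)%type.

Definition leb3 {R : realType} : {measure set (R3 R) -> \bar R} :=
  ((@lebesgue_measure R \x @lebesgue_measure R) \x @lebesgue_measure R)%E.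

Definition ebase {R : realType} (j : 'I_3) : R3 R :=
  ((j == 0%N :> nat)%:R, (j == 1%N :> nat)%:R, (j == 2%N :> nat)%:R).

Definition partial {R : realType} (j : 'I_3) (f : R3 R -> R) : R3 R -> R :=
  fun x => 'D_(ebase j) f x.

Definition smooth {R : realType} (f : R3 R -> R) : Prop :=
  forall s : seq 'I_3, let g := foldr partial f s in
    continuous g /\ (forall (j : 'I_3) (x : R3 R), derivable g x (ebase j)).

(* [f] is in C_c^oo(Om), seen as a function on all of R^3. *)
Definition test_fun {R : realType} (Om : set (R3 R)) (f : R3 R -> R) : Prop :=
  [/\ smooth f, compact (closure [set x | f x != 0])
    & closure [set x | f x != 0] `<=` Om].

(* Euclidean norm of a row vector (m = 1); Frobenius norm of a matrix. *)
Definition enorm {R : realType} {m n : nat} (A : 'M[R]_(m, n)) : R :=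
  Num.sqrt (\sum_(i < m) \sum_(j < n) A i j ^+ 2).

Definition measurable_field {R : realType} {m n : nat} (Om : set (R3 R))
    (M : R3 R -> 'M[R]_(m, n)) : Prop :=
  forall i j, measurable_fun Om (fun x => M x i j).

(* For m = 1 this is the usual L^q-norm of a vector field. *)
Definition Lq_norm {R : realType} {m n : nat} (q : R) (Om : set (R3 R))
    (M : R3 R -> 'M[R]_(m, n)) : \bar R :=
  ((\int[leb3]_(x in Om) (\sum_(i < m) enorm (row i (M x)) `^ q)%:E)
     `^ q^-1)%E.

(* The zero extension does not affect the essential supremum over [Om] of a
   nonnegative function, [Om] being open and nonempty. *)
Definition Linfty_norm {R : realType} {m n : nat} (Om : set (R3 R))
    (M : R3 R -> 'M[R]_(m, n)) : \bar R :=
  ess_sup leb3 (fun x => if x \in Om then (enorm (M x))%:E else 0%:E).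

Definition in_Lq {R : realType} {m n : nat} (q : R) (Om : set (R3 R))
    (M : R3 R -> 'M[R]_(m, n)) : Prop :=
  measurable_field Om M /\ (Lq_norm q Om M < +oo)%E.

Definition in_Linfty {R : realType} {m n : nat} (Om : set (R3 R))
    (M : R3 R -> 'M[R]_(m, n)) : Prop :=
  measurable_field Om M /\ (Linfty_norm Om M < +oo)%E.

(* [G] is the weak derivative of [u] in [Om]; row i of [G] is the gradient of
   the i-th component. Used only for [u] and [G] in L^q, so that all the
   integrals converge absolutely. *)
Definition weak_derivative {R : realType} (Om : set (R3 R))
    (u : R3 R -> 'rV[R]_3) (G : R3 R -> 'M[R]_3) : Prop :=
  forall (f : R3 R -> R), test_fun Om f -> forall i j : 'I_3,
    (\int[leb3]_(x in Om) (u x ord0 i * partial j f x)%:E =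
     - \int[leb3]_(x in Om) (G x i j * f x)%:E)%E.

(* [u] belongs to W^{1,q}(Om; R^3) and [Du = G]; [G] is unique up to null
   sets. *)
Definition in_W1q {R : realType} (q : R) (Om : set (R3 R))
    (u : R3 R -> 'rV[R]_3) (G : R3 R -> 'M[R]_3) : Prop :=
  [/\ in_Lq q Om u, in_Lq q Om G & weak_derivative Om u G].

Definition jacobian {R : realType} (f : R3 R -> 'rV[R]_3) : R3 R -> 'M[R]_3 :=
  fun x => \matrix_(i < 3, j < 3) partial j (fun y => f y ord0 i) x.

(* [u] belongs to W_0^{1,q}(Om; R^3), the closure of C_c^oo(Om; R^3) in
   W^{1,q}(Om; R^3) for the norm ||u||_q + ||Du||_q, and [Du = G]. *)
Definition in_W1q0 {R : realType} (q : R) (Om : set (R3 R))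
    (u : R3 R -> 'rV[R]_3) (G : R3 R -> 'M[R]_3) : Prop :=
  in_W1q q Om u G /\
  forall eps : R, 0 < eps -> exists f : R3 R -> 'rV[R]_3,
    (forall i : 'I_3, test_fun Om (fun x => f x ord0 i)) /\
    (Lq_norm q Om (fun x => (u x - f x)%R) +
     Lq_norm q Om (fun x => (G x - jacobian f x)%R) < eps%:E)%E.

(* Main.v *)
(* If the third row of [Du] vanishes and the first two rows [G1], [G2] are uniformly
   independent, then [Du P] is skew for the matrix [P] of determinant 1 with columns
   [G1 x n/|n|^2], [G2 x n/|n|^2], [n], where [n = G1 x G2].  On a shell
   [a < |x - p|_oo < b] take [u1 = rho], the distance to the boundary of the
   shell, whose gradient is some [+-e_i], and [u2 = rho + W],
   where [W] is obtained from the linear function [k (x1 + x2 + x3) + 1/2] by folding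
   it infinitely often, [V <- min(V, max(rho, 2^-m) - V)].  Each fold only flips the
   sign of the gradient or adds [grad rho] to it, so [grad W = +-k (1,1,1) + t grad rho]
   with [t] in [{0, 1}], while [0 <= W <= rho] vanishes on the boundary.  Disjoint
   shells of thickness [d_n -> 0] and volume at least of order [d_n], which determine
   one common [P], give functions with [|u_n|_oo <= C d_n] and [|Du_n|_q >= c d_n^(1/q)];
   after normalization [|u_n|_oo <= C d_n^(1 - 1/q) -> 0] because [q > 1].

   That [u_n] lies in [W_0^{1,q}] follows from stability of approximability by smooth
   functions under sums, positive parts and limits; the positive part is smoothed by
   [t exp(-e/t)], which has slopes in [0, 1] and vanishes for [t <= 0]. *)
Require Import Defs.
From HB Require Import structures.
From mathcomp Require Import all_boot all_order all_algebra.
From mathcomp Require Import all_classical all_reals all_analysis ess_sup_inf.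
From mathcomp Require Import measurable_realfun.
From mathcomp Require Import ring lra.
Import Order.TTheory GRing.Theory Num.Theory.
Import numFieldNormedType.Exports.
Local Open Scope classical_set_scope.
Local Open Scope ring_scope.
Set Implicit Arguments.
Unset Strict Implicit.
Unset Printing Implicit Defensive.

(** * Borel sets of [R^3] *)

(** One [P] must serve every [u_n]. Off its own shell [Du_n] is zero and skewness is trivial, so
    disjointness lets each shell prescribe [P] for itself; boundedness of [P] then requires
    [|G1 x G2|] to be bounded below independently of the shell. Multiplying the linear function by a
    cutoff [phi(rho)] would give zero boundary values, but the cross product with [grad rho] would
    carry the factor [phi(rho)] and degenerate at the boundary. Folding keeps the factor at [+-1]
    and otherwise adds only [grad rho], which drops out of the cross product. The max norm makes
    [grad rho] a signed basis vector, and [(1,1,1)] has the same angle with every axis, so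
    [|G1 x G2|^2] is exactly [2 k^2].

    The summand [rho] in [u2 = rho + W] does not change the cross product; it makes [u2] positive on
    the whole open shell. Gradients are functions with a definite value at every point, and the
    truncation that produces compact supports needs them to be zero wherever the component vanishes;
    [W] alone might vanish inside the shell with gradient [+-k(1,1,1)] there. *)

Lemma open_measurable3 {R : realType} (U : set (R3 R)) : open U -> measurable U.
Proof.
move=> oU.
(* Measurability refers to the product sigma-algebra, so [U] is written as a countable union of
   rational boxes. A box of radius below [e / 2] that contains [x] lies in the [e]-ball of [x]. *)
pose box (a : rat * rat * rat) (n : nat) : set (R3 R) :=
  (ball (ratr a.1.1 : R) (n.+1%:R^-1 : R) `*` ball (ratr a.1.2 : R) (n.+1%:R^-1 : R))
   `*` ball (ratr a.2 : R) (n.+1%:R^-1 : R).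
have mbox a n : measurable (box a n).
  by apply: measurableX; [apply: measurableX|]; apply: open_measurable; exact: ball_open.
have -> : U = \bigcup_(an in [set an : (rat * rat * rat) * nat | box an.1 an.2 `<=` U])
    box an.1 an.2.
  apply/seteqP; split => [x Ux|x [an anU anx]]; last exact: anU.
  have : nbhs x U by rewrite nbhsE /=; exists U.
  rewrite -nbhs_ballE => -[e /= e0 xeU].
  have [n /= ne] : exists n : nat, n.+1%:R^-1 < e / 2 :> R.
    have e20 : 0 < e / 2 by rewrite divr_gt0.
    near (\oo : set_system nat) => n; exists n.
    by near: n; exact: near_infty_natSinv_lt (PosNum e20).
  have [w [wE w0 we]] : exists w : R, [/\ w = n.+1%:R^-1, 0 < w & w < e / 2].
    by exists n.+1%:R^-1; split => //; rewrite invr_gt0.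
  have ex (t : R) : exists q : rat, `|ratr q - t| < w.
    have : t - w < t + w by lra.
    move=> /rat_in_itvoo[p]; rewrite in_itv /= => /andP[? ?].
    by exists p; rewrite ltr_norml; apply/andP; split; lra.
  have [q1 h1] := ex x.1.1; have [q2 h2] := ex x.1.2; have [q3 h3] := ex x.2.
  exists ((q1, q2, q3), n); rewrite /= /box -wE; last first.
    by split; [split|].
  move=> y /= [[/= y1 y2] y3]; apply: xeU.
  have aux (s t u : R) : `|s - t| < w -> ball s w u -> ball t e u.
    rewrite /ball /= !ltr_norml => /andP[? ?] /andP[? ?].
    by apply/andP; split; lra.
  by split; [split|]; [apply: (aux _ _ _ h1) | apply: (aux _ _ _ h2) | apply: (aux _ _ _ h3)].
rewrite bigcup_mkcond; apply: countable_bigcupT_measurable => [|an].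
  exact: countableP.
by case: ifP.
Unshelve. all: end_near. Qed.

Lemma continuous_measurable3 {R : realType} (f : R3 R -> R) :
  continuous f -> measurable_fun setT f.
Proof.
move=> cf; apply: (measurability _ (RGenOpens.measurableE R)) => //.
move=> _ [_ [a [b ->] <-]]; rewrite setTI; apply: open_measurable3.
by apply: open_comp => // x _; exact: cf.
Qed.

Lemma leb3_box {R : realType} (A B C : set (measurableTypeR R)) :
  measurable A -> measurable B -> measurable C ->
  leb3 ((A `*` B) `*` C) = (lebesgue_measure A * lebesgue_measure B * lebesgue_measure C)%E.
Proof.
move=> mA mB mC; rewrite /leb3 /= product_measure1E//=; last exact: measurableX.
by rewrite product_measure1E.
Qed.

(** * Smooth functions *)

(** Only directional derivatives are given, not differentiability; restricting to a line makes the
    one-variable chain rule and mean value theorem applicable. *)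
Lemma is_derive_line {R : realType} (V : normedModType R) (f : V -> R) (x v : V) df :
  is_derive x v f df <-> is_derive (0 : R) (1 : R) (fun h : R => f (h *: v + x)) df.
Proof.
have D1 : 'D_v f x = 'D_(1 : R) (fun h : R => f (h *: v + x)) (0 : R).
  rewrite /derive; set g1 := fun h => h^-1 *: _; set g2 := fun h => h^-1 *: _.
  suff -> : g1 = g2 by [].
  by rewrite funeqE /g1 /g2 => h /=; rewrite addr0 scale0r add0r [_%:A]mulr1.
split=> -[d dE]; apply: DeriveDef.
- exact: (derivable1P f x v).1 d.
- by rewrite -D1.
- exact: (derivable1P f x v).2 d.
- by rewrite D1.
Qed.

Lemma is_derive_comp {R : realType} (V : normedModType R) (f : V -> R) (g : R -> R)
    (x v : V) df dg :
  is_derive x v f df -> is_derive (f x) 1 g dg -> is_derive x v (g \o f) (dg * df).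
Proof.
move=> /is_derive_line [df1 dfE] [dg1 dgE]; apply/is_derive_line.
have fx : f (0 *: v + x) = f x by rewrite scale0r add0r.
have dgf : derivable g (f (0 *: v + x)) 1 by rewrite fx.
have -> : (fun h : R => (g \o f) (h *: v + x)) = g \o (fun h : R => f (h *: v + x)) by [].
split.
  apply: (derivable1_diffP _ _).2; apply: differentiable_comp.
    exact: (derivable1_diffP _ _).1 df1.
  exact: (derivable1_diffP _ _).1 dgf.
have := derive1_comp df1 dgf; rewrite (derive1E (g \o _)) (derive1E g) (derive1E (fun h => _)).
by rewrite dfE fx dgE.
Qed.

(* [t^-k exp(-e/t)] for [t > 0]; this family is closed under derivation up to linear
   combinations, which gives smoothness at 0. *)
Definition flat {R : realType} (e : R) (k : nat) (t : R) : R :=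
  if 0 < t then t^-1 ^+ k * expR (- (e * t^-1)) else 0.

Section flat.
Context {R : realType} (e : R).
Hypothesis e0 : 0 < e.

Lemma flat_ge0 k t : 0 <= flat e k t.
Proof.
rewrite /flat; case: ifPn => // t0.
by rewrite mulr_ge0 ?expR_ge0// exprn_ge0// invr_ge0 ltW.
Qed.

(** A single term of the exponential series: [s^k / k! <= exp s]. *)
Lemma powM_expRN_le (k : nat) (s : R) : 0 <= s -> s ^+ k * expR (- s) <= k`!%:R.
Proof.
move=> s0; rewrite expRN ler_pdivrMr ?expR_gt0//; case: k => [|k].
  by rewrite expr0 fact0 mul1r -[leLHS]expR0 ler_expR.
rewrite mulrC -ler_pdivrMr ?ltr0n ?fact_gt0//.
by apply: le_trans (expR_ge1Dxn k s0); rewrite lerDr.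
Qed.

Lemma flat_bounded k t : flat e k t <= k`!%:R / e ^+ k.
Proof.
rewrite /flat; case: ifPn => [t0|_]; last by rewrite divr_ge0// exprn_ge0// ltW.
have s0 : 0 <= e * t^-1 by rewrite mulr_ge0 ?invr_ge0// ltW.
rewrite ler_pdivlMr ?exprn_gt0// mulrAC -exprMn (mulrC t^-1).
exact: powM_expRN_le.
Qed.

Lemma flatSM k t : t * flat e k.+1 t = flat e k t.
Proof.
rewrite /flat; case: ifPn => [t0|_]; last by rewrite mulr0.
by rewrite exprS !mulrA mulfV ?mul1r// gt_eqF.
Qed.

Lemma is_derive_flat k (t : R) :
  is_derive t (1 : R) (flat e k) (- k%:R * flat e k.+1 t + e * flat e k.+2 t).
Proof.
have [t0|t0|->] := ltgtP t 0.
- have -> : - k%:R * flat e k.+1 t + e * flat e k.+2 t = 0.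
    by rewrite /flat ltNge (ltW t0) /= !mulr0 addr0.
  apply: (@near_eq_is_derive _ _ _ (cst 0)).
    by near=> y; rewrite /flat ltNge (_ : y <= 0)//; near: y; exact: lt_le_nbhsl.
- pose g : R -> R := ((fun y : R => y^-1) ^+ k) * (expR \o (fun y : R => - (e * y^-1))).
  apply: (@near_eq_is_derive _ _ _ g).
    near=> y; have y0 : 0 < y by near: y; exact: lt_nbhsr.
    by rewrite /flat y0 /g -[LHS]/(((fun y : R => y^-1) ^+ k) y * _) exprfctE.
  have dinv : is_derive t (1 : R) (fun y : R => y^-1) (- t ^- 2).
    apply: DeriveDef; first by apply: derivableV => //; rewrite gt_eqF.
    by rewrite deriveV ?gt_eqF// derive_id /GRing.scale /= mulr1.
  have dexp : is_derive t (1 : R) (expR \o (fun y : R => - (e * y^-1)))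
      (expR (- (e * t^-1)) * (e * t ^- 2)).
    apply: is_derive_comp.
    have H : is_derive t (1 : R) (fun y : R => - (e * y^-1)) _ := is_deriveN (is_deriveZ e dinv).
    by apply: (is_derive_eq H); rewrite /GRing.scale /= mulrN opprK.
  apply: (is_derive_eq (is_deriveM (is_deriveX k dinv) dexp)).
  rewrite /flat t0 /GRing.scale /= exprfctE.
  case: (k) => [|m]; first by rewrite -!exprVn; ring.
  by rewrite /= -!exprVn !exprS; ring.
- rewrite /flat ltxx !mulr0 addr0 -/(flat e k).
  have cvg : (fun h : R => h^-1 *: ((flat e k \o shift 0) (h *: 1) - flat e k 0)) @ 0^' --> (0 : R).
    apply/cvgr0Pnorm_lt => eps eps0.
    pose B := 1 + k.+2`!%:R / e ^+ k.+2.
    have B0 : 0 < B by rewrite ltr_pwDl// divr_ge0// exprn_ge0// ltW.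
    near=> h; rewrite /= addr0 [_%:A]mulr1 [flat e k 0]/flat ltxx subr0.
    have h0 : h != 0 by near: h; exact: nbhs_dnbhs_neq.
    (* By [flatSM] used twice, [flat e k h / h = h * flat e k.+2 h], and the last factor is
       bounded. *)
    rewrite -flatSM /GRing.scale /= mulrA mulVf// mul1r -flatSM normrM.
    rewrite (@le_lt_trans _ _ (`|h| * B))//.
      rewrite ler_wpM2l// ger0_norm ?flat_ge0//.
      by rewrite (le_trans (flat_bounded _ _))// lerDr.
    rewrite -ltr_pdivlMr//; near: h; apply: dnbhs0_lt; exact: divr_gt0.
  by apply: DeriveDef; [apply/cvg_ex; exists 0|exact: cvg_lim cvg].
Unshelve. all: by end_near. Qed.

End flat.

Definition crd {R : realType} (j : 'I_3) (x : R3 R) : R :=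
  if j == 0%N :> nat then x.1.1 else if j == 1%N :> nat then x.1.2 else x.2.

Lemma continuous_crd {R : realType} (j : 'I_3) : continuous (@crd R j).
Proof.
have c1 (T U : topologicalType) : continuous (@fst T U) by move=> [a b]; exact: cvg_fst.
have c2 (T U : topologicalType) : continuous (@snd T U) by move=> [a b]; exact: cvg_snd.
case: j => [[|[|[|//]]] ?] x; rewrite /crd /=; last exact: c2.
- exact: (@continuous_comp (R3 R) (measurableTypeR R * measurableTypeR R)%type
    (measurableTypeR R) fst fst x (c1 _ _ x) (c1 _ _ x.1)).
- exact: (@continuous_comp (R3 R) (measurableTypeR R * measurableTypeR R)%type
    (measurableTypeR R) fst snd x (c1 _ _ x) (c2 _ _ x.1)).
Qed.

Lemma is_derive_crd {R : realType} (i j : 'I_3) (x : R3 R) :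
  is_derive x (ebase j) (crd i : R3 R -> R) (i == j)%:R.
Proof.
apply/is_derive_line.
have crdE (h : R) : crd i (h *: ebase j + x) = h * (i == j)%:R + crd i x.
  by case: i => [[|[|[|//]]] ?]; case: j => [[|[|[|//]]] ?].
have -> : (fun h : R => crd i (h *: ebase j + x)) = (fun h : R => h * (i == j)%:R + crd i x).
  by apply/funext => h; rewrite crdE.
have H : is_derive (0 : R) (1 : R) (fun h : R => h * (i == j)%:R + crd i x) _ :=
  is_deriveD (is_deriveM (is_derive_id (0 : R) (1 : R)) (is_derive_cst ((i == j)%:R : R) (0 : R) (1 : R)))
   (is_derive_cst (crd i x) (0 : R) (1 : R)).
by apply: (is_derive_eq H); rewrite /GRing.scale /= mulr0 mulr1 add0r addr0.
Qed.

(* Closed under partial derivatives, so that its members are smooth. *)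
Inductive sm {R : realType} : (R3 R -> R) -> Prop :=
| sm_cst (a : R) : sm (fun=> a)
| sm_crd (j : 'I_3) : sm (crd j)
| sm_add f g : sm f -> sm g -> sm (fun x => f x + g x)
| sm_mul f g : sm f -> sm g -> sm (fun x => f x * g x)
| sm_flat e k f : 0 < e -> sm f -> sm (fun x => flat e k (f x)).

Section smooth_expressions.
Context {R : realType}.
Implicit Types (f : R3 R -> R).

Lemma sm_derive f : sm f ->
  continuous f /\
  forall j, exists df, sm df /\ forall x : R3 R, is_derive x (ebase j) f (df x).
Proof.
elim => [a|i|{}f g _ [cf df] _ [cg dg]|{}f g smf [cf df] smg [cg dg]|e k {}f e0 smf [cf df]].
- split=> [x|j]; first exact: cvg_cst.
  by exists (fun=> 0); split; [exact: sm_cst|move=> x; exact: is_derive_cst].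
- split=> [x|j]; first exact: continuous_crd.
  exists (fun=> (i == j)%:R); split; [exact: sm_cst|move=> x; exact: is_derive_crd].
- split=> [x|j]; first by apply: cvgD; [exact: cf|exact: cg].
  have [f' [smf' f'E]] := df j; have [g' [smg' g'E]] := dg j.
  exists (fun x => f' x + g' x); split; first exact: sm_add.
  by move=> x; exact: (is_deriveD (f'E x) (g'E x)).
- split=> [x|j]; first by apply: cvgM; [exact: cf|exact: cg].
  have [f' [smf' f'E]] := df j; have [g' [smg' g'E]] := dg j.
  exists (fun x => f x * g' x + g x * f' x); split.
    by apply: sm_add; apply: sm_mul.
  by move=> x; exact: (is_deriveM (f'E x) (g'E x)).
- split=> [x|j].
    apply: (@cvg_comp _ _ _ f (flat e k)); first exact: cf.
    have [d _] := is_derive_flat e0 k (f x).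
    exact: (differentiable_continuous ((derivable1_diffP _ _).1 d)).
  have [f' [smf' f'E]] := df j.
  exists (fun x => (- k%:R * flat e k.+1 (f x) + e * flat e k.+2 (f x)) * f' x); split.
    apply: sm_mul => //; apply: sm_add; apply: sm_mul; try exact: sm_cst; exact: sm_flat.
  by move=> x; exact: (is_derive_comp (f'E x) (is_derive_flat e0 k (f x))).
Qed.

Lemma sm_partial f j : sm f -> sm (partial j f).
Proof.
move=> /sm_derive[_ /(_ j)[df [smdf dfE]]].
suff -> : partial j f = df by [].
by apply/funext => x; case: (dfE x).
Qed.

Lemma sm_is_derive f j x : sm f -> is_derive x (ebase j) f (partial j f x).
Proof.
by move=> /sm_derive[_ /(_ j)[df [_ /(_ x) dfE]]]; case: dfE => d _; exact: derivableP d.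
Qed.

Lemma sm_smooth f : sm f -> smooth f.
Proof.
move=> smf s; have : sm (foldr partial f s).
  by elim: s => //= j s; exact: sm_partial.
move=> /[dup] smg /sm_derive[cg _]; split => // j x.
by case: (sm_is_derive j x smg).
Qed.

Lemma sm_measurable f : sm f -> measurable_fun setT f.
Proof. by move=> /sm_derive[cf _]; exact: continuous_measurable3. Qed.
End smooth_expressions.

(** * Integration by parts *)

Lemma lebesgue_itv_lty {R : realType} (a b : R) :
  (@lebesgue_measure R `[a, b] < +oo)%E.
Proof. by rewrite lebesgue_measure_itv/=; case: ifP => _; rewrite ltry. Qed.

Definition cube {R : realType} (M : R) : set (R3 R) :=
  let I : set (measurableTypeR R) := `[(- M), M]%classic in (I `*` I) `*` I.

Lemma leb3_cube_lty {R : realType} (M : R) : (leb3 (cube M) < +oo)%E.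
Proof.
rewrite /cube; set I : set (measurableTypeR R) := `[_, _]%classic; rewrite leb3_box; try exact: measurable_itv.
have fI : lebesgue_measure I \is a fin_num.
  by rewrite ge0_fin_numE ?lebesgue_itv_lty.
by rewrite -ge0_fin_numE ?mule_ge0 ?fin_numM.
Qed.

Lemma notin_itv_norm {R : realType} (M t : R) : 0 < M -> t \notin `[(- M), M] -> M <= `|t|.
Proof.
move=> M0; rewrite in_itv/= => /nandP[]; rewrite -ltNge => tM.
  by rewrite ler0_norm; lra.
by rewrite ger0_norm; lra.
Qed.

Lemma bounded_supp_integrable {R : realType} d (T : measurableType d)
    (mu : {measure set T -> \bar R}) (A : set T) (C : R) (f : T -> R) :
  measurable A -> (mu A < +oo)%E -> measurable_fun setT f ->
  (forall x, `|f x| <= C) -> (forall x, ~ A x -> f x = 0) ->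
  mu.-integrable setT (EFin \o f).
Proof.
move=> mA muA mf fC fA.
have -> : EFin \o f = (EFin \o f) \_ A.
  by apply/funext => x; rewrite patchE; case: ifPn => //= /negP xA; rewrite fA// => /mem_set.
apply/(integrable_mkcond _ mA); apply: measurable_bounded_integrable => //.
  exact: measurable_funTS.
by exists C; split; [exact: num_real|move=> D CD x _; exact: le_trans (fC x) (ltW CD)].
Qed.

Lemma integral_derive0 {R : realType} (g G : R -> R) (M : R) :
  0 < M -> (forall t, is_derive t (1 : R) g (G t)) -> continuous G ->
  (forall t, M <= `|t| -> g t = 0 /\ G t = 0) ->
  (\int[@lebesgue_measure R]_t (G t)%:E = 0)%E.
Proof.
move=> M0 dg cG supp.
have cg : continuous g.
  by move=> t; have [d _] := dg t; exact: (differentiable_continuous ((derivable1_diffP _ _).1 d)).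
have NMM : - M < M by lra.
transitivity (\int[@lebesgue_measure R]_(t in `[(- M)%R, M]) (G t)%:E)%E.
  rewrite [RHS]integral_mkcond; apply: eq_integral => t _; rewrite patchE.
  case: ifPn => //; rewrite notin_setE/= => /negP tM.
  by rewrite (supp t _).2//; apply: notin_itv_norm.
rewrite (@continuous_FTC2 _ G g)//; last 3 first.
- exact: continuous_subspaceT.
- split; [by move=> t _; case: (dg t)|exact: cvg_at_right_filter (cg _)|exact: cvg_at_left_filter (cg _)].
- by move=> t _; rewrite derive1E; case: (dg t).
(* The vanishing hypothesis is stated with [M <= |t|], so it includes both end points. *)
rewrite (supp M _).1; last by rewrite ger0_norm// ltW.
rewrite (supp (- M) _).1; last by rewrite normrN ger0_norm// ltW.
by rewrite sube0.
Qed.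

Lemma is_derive_slice {R : realType} (h : R3 R -> R) (j : 'I_3) (x : R3 R) (a df : R) :
  is_derive (a *: ebase j + x : R3 R) (ebase j) h df ->
  is_derive a (1 : R) (fun t : R => h (t *: ebase j + x)) df.
Proof.
move=> /is_derive_line H; apply/is_derive_line.
rewrite (_ : (fun t : R => h ((t *: 1 + a) *: ebase j + x)) =
  (fun t : R => h (t *: ebase j + (a *: ebase j + x))))//.
by apply/funext => t; rewrite scalerDl addrA [t%:A]mulr1.
Qed.

Lemma continuous_line {R : realType} (V : normedModType R) (v x : V) :
  continuous (fun t : R => t *: v + x).
Proof. by move=> t; apply: cvgD; [exact: scalel_continuous|exact: cvg_cst]. Qed.

(* The canonical sigma-finite structure that the library infers for a product
   measure only covers subprobabilities. *)
Definition leb2 {R : realType} : set (measurableTypeR R * measurableTypeR R) -> \bar R :=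
  (@lebesgue_measure R \x @lebesgue_measure R)%E.

HB.instance Definition _ (R : realType) := Measure.on (@leb2 R).

Lemma leb2_square_lty {R : realType} (M : R) :
  let I : set (measurableTypeR R) := `[(- M), M]%classic in
  ((leb2 (I `*` I) < +oo)%E : Prop).
Proof.
have mI : measurable (`[(- M), M]%classic : set (measurableTypeR R)) by exact: measurable_itv.
rewrite /= [ltLHS]product_measure1E//.
have fI : lebesgue_measure (`[(- M), M]%classic : set R) \is a fin_num.
  by rewrite ge0_fin_numE ?lebesgue_itv_lty.
by rewrite -ge0_fin_numE ?mule_ge0 ?fin_numM.
Qed.

Lemma leb2_sigma_finite {R : realType} : sigma_finite setT (@leb2 R).
Proof.
pose I (n : nat) : set (measurableTypeR R) := `[(- n%:R), n%:R]%classic.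
exists (fun n => I n `*` I n); last first.
  by move=> n; split; [apply: measurableX; exact: measurable_itv|exact: leb2_square_lty].
apply/seteqP; split => // x _.
have [n nP] : exists n : nat, Num.max `|x.1| `|x.2| <= n%:R.
  by eexists; apply/ltW/archi_boundP; rewrite le_max normr_ge0.
exists n => //; move: nP; rewrite ge_max => /andP[].
by rewrite /I /= !in_itv/= -!ler_norml.
Qed.

HB.instance Definition _ (R : realType) :=
  Measure_isSigmaFinite.Build _ _ _ (@leb2 R) leb2_sigma_finite.

Section iterated_integrals.
Context {R : realType}.
Variable f : R3 R -> \bar R.
Local Notation mu := (@lebesgue_measure R).
Hypothesis intf : (@leb3 R).-integrable setT f.
Hypothesis intf2 : forall z, (@leb2 R).-integrable setT (fun p => f (p, z)).
Local Open Scope ereal_scope.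

Let intf' : (@leb2 R \x mu).-integrable setT f := intf.

(** Together with [integral_leb3_zyx] and [integral_leb3_zxy], this makes each of the three
    coordinates the innermost variable once. *)
Lemma integral_leb3_p : \int[leb3]_w f w = \int[@leb2 R]_p \int[mu]_z f (p, z).
Proof. exact: esym (integral12_prod_meas1 intf'). Qed.

Lemma integral_leb3_z : \int[leb3]_w f w = \int[mu]_z \int[@leb2 R]_p f (p, z).
Proof. exact: esym (integral21_prod_meas1 intf'). Qed.

Lemma integral_leb3_zyx :
  \int[leb3]_w f w = \int[mu]_z \int[mu]_y \int[mu]_x f ((x, y), z).
Proof.
rewrite integral_leb3_z; apply: eq_integral => z _.
exact: esym (integral21_prod_meas1 (intf2 z)).
Qed.

Lemma integral_leb3_zxy :
  \int[leb3]_w f w = \int[mu]_z \int[mu]_x \int[mu]_y f ((x, y), z).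
Proof.
rewrite integral_leb3_z; apply: eq_integral => z _.
exact: esym (integral12_prod_meas1 (intf2 z)).
Qed.
End iterated_integrals.

Lemma scale_ebaseD {R : realType} (j : 'I_3) (t : R) (x : R3 R) :
  t *: ebase j + x = ((t * (j == 0%N :> nat)%:R + x.1.1, t * (j == 1%N :> nat)%:R + x.1.2),
    t * (j == 2%N :> nat)%:R + x.2).
Proof. by []. Qed.

Section integral_partial.
Context {R : realType}.
Variables (j : 'I_3) (h H : R3 R -> R) (M C : R).
Hypothesis M0 : 0 < M.
Hypothesis dh : forall x : R3 R, is_derive x (ebase j) h (H x).
Hypothesis cH : continuous H.
Hypothesis HC : forall x, `|H x| <= C.
Hypothesis supp : forall x i, M <= `|crd i x| -> h x = 0 /\ H x = 0.

Let mu := @lebesgue_measure R.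
Let mH : measurable_fun setT H := continuous_measurable3 cH.
Let I : set (measurableTypeR R) := `[(- M), M]%classic.
Let mI : measurable I. Proof. exact: measurable_itv. Qed.

Let IP (t : R) : ~ I t -> M <= `|t|.
Proof. by move=> nI; apply: notin_itv_norm => //; apply/negP. Qed.

Let suppI x : ~ ((I `*` I) `*` I) x -> H x = 0.
Proof.
move=> nx; have : ~ I x.1.1 \/ ~ I x.1.2 \/ ~ I x.2.
  have [a|?] := pselect (I x.1.1); last by left.
  have [b|?] := pselect (I x.1.2); last by right; left.
  by right; right => c; apply: nx.
case=> [/IP|[/IP|/IP]] xM.
- exact: (@supp x 0 xM).2.
- exact: (@supp x 1 xM).2.
- exact: (@supp x 2 xM).2.
Qed.

Let intH : (leb3 : {measure set (R3 R) -> \bar R}).-integrable setT (EFin \o H).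
Proof.
apply: (@bounded_supp_integrable _ _ _ _ ((I `*` I) `*` I) C) => //.
- by apply: measurableX => //; exact: measurableX.
- exact: leb3_cube_lty.
Qed.

(** Because [crd j x = 0], the parameter [t] is itself the [j]-th coordinate of the point, so the
    support condition can be read off from [t]. *)
Let line (x : R3 R) : crd j x = 0 ->
  (\int[mu]_t (H (t *: ebase j + x))%:E = 0)%E.
Proof.
move=> xj; apply: (@integral_derive0 _ (fun t : R => h (t *: ebase j + x)) _ M) => //.
- by move=> t; exact: is_derive_slice.
- move=> t; apply: continuous_comp; last exact: cH.
  exact: continuous_line.
- move=> t tM; apply: (@supp _ j).
  by move: j xj tM => [[|[|[|//]]] ?]; rewrite /crd /= => ->; rewrite addr0 [_ *: _]mulr1.
Qed.

Let int2 z : (@leb2 R).-integrable setT (fun p => (H (p, z))%:E).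
Proof.
apply: (@bounded_supp_integrable _ _ _ _ (I `*` I) C (fun p => H (p, z))) => //.
- exact: measurableX.
- exact: leb2_square_lty.
- exact: measurableT_comp mH (pair2_measurable z).
- by move=> p nIp; apply: suppI => -[].
Qed.

(** Fubini with the [j]-th variable innermost; every inner integral vanishes by [line]. *)
Lemma integral_partial0 : (\int[leb3]_x (H x)%:E = 0)%E.
Proof.
case: j line => [[|[|[|//]]] jlt] ln.
- rewrite (integral_leb3_zyx intH int2) integral0_eq// => z _.
  rewrite integral0_eq// => y _.
  rewrite -[RHS](ln ((0, y), z) erefl); apply: eq_integral => x _.
  by congr (H _)%:E; rewrite scale_ebaseD /= !(mulr1, mulr0, add0r, addr0).
- rewrite (integral_leb3_zxy intH int2) integral0_eq// => z _.
  rewrite integral0_eq// => x _.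
  rewrite -[RHS](ln ((x, 0), z) erefl); apply: eq_integral => y _.
  by congr (H _)%:E; rewrite scale_ebaseD /= !(mulr1, mulr0, add0r, addr0).
- rewrite (integral_leb3_p intH) integral0_eq// => -[x y] _.
  rewrite -[RHS](ln ((x, y), 0) erefl); apply: eq_integral => z _.
  by congr (H _)%:E; rewrite scale_ebaseD /= !(mulr1, mulr0, add0r, addr0).
Qed.
End integral_partial.

Lemma crd_le_norm {R : realType} i (x : R3 R) : `|crd i x| <= `|x|.
Proof.
rewrite prod_normE /= [`|x.1|]prod_normE !le_max.
by case: i => [[|[|[|//]]] ?]; rewrite /crd /= lexx ?orbT.
Qed.

Lemma continuous_supp_bounded {R : realType} (T : topologicalType) (K : set T) (g : T -> R) :
  compact K -> continuous g -> (forall x, ~ K x -> g x = 0) ->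
  exists C, 0 <= C /\ forall x, `|g x| <= C.
Proof.
move=> cK cg gK.
have /compact_bounded [M [_ HM]] : compact (g @` K).
  by apply: continuous_compact => //; exact: continuous_subspaceT.
exists (Num.max 0 (M + 1)); split; first by rewrite le_max lexx.
move=> x; rewrite le_max; have [Kx|nK] := pselect (K x).
  by apply/orP; right; apply: (HM (M + 1)); [rewrite ltrDl|exists x].
by rewrite gK// normr0 lexx.
Qed.

Section test_functions.
Context {R : realType} (Om : set (R3 R)) (phi : R3 R -> R).
Hypothesis tphi : test_fun Om phi.
Let K := closure [set x | phi x != 0].

Lemma test_fun_partial_eq0 j x : ~ K x -> partial j phi x = 0.
Proof.
move=> nK; rewrite /partial -[RHS](derive_cst (0 : R) x (ebase j : R3 R)).
apply: near_eq_derive; have : nbhs x (~` K).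
  by apply: open_nbhs_nbhs; split => //; apply: closed_openC; exact: closed_closure.
apply: filterS => y nKy; apply/eqP/negP => /negP py; apply: nKy.
exact: subset_closure.
Qed.

Lemma test_fun_eq0 x : ~ K x -> phi x = 0.
Proof.
by move=> nK; apply/eqP/negP => /negP py; apply: nK; exact: subset_closure.
Qed.

Lemma test_fun_continuous : continuous phi.
Proof. by case: tphi => /(_ [::])[]. Qed.

Lemma test_fun_continuous_partial j : continuous (partial j phi).
Proof. by case: tphi => /(_ [:: j])[]. Qed.

Lemma test_fun_is_derive j (x : R3 R) : is_derive x (ebase j) phi (partial j phi x).
Proof. by case: tphi => /(_ [::])[_ /= /(_ j x) d] _ _; exact: derivableP. Qed.

Lemma test_fun_supp : exists2 M, 0 < M & forall x i, M <= `|crd i x| -> ~ K x.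
Proof.
case: tphi => _ /compact_bounded[M [_ HM]] _.
exists (Num.max 1 (M + 2)); first by rewrite lt_max ltr01.
move=> x i Mx Kx; have := HM (M + 1) _ x Kx.
rewrite ltrDl ltr01 => /(_ isT) /(le_trans (crd_le_norm i x)).
by move: Mx; rewrite ge_max => /andP[_ Mx] /(le_trans Mx); lra.
Qed.

Lemma test_fun_bounded : exists C, [/\ 0 <= C, forall x, `|phi x| <= C &
  forall j x, `|partial j phi x| <= C].
Proof.
have cK : compact K by case: tphi.
have [C [C0 HC]] := continuous_supp_bounded cK test_fun_continuous test_fun_eq0.
have H j := continuous_supp_bounded cK (@test_fun_continuous_partial j) (@test_fun_partial_eq0 j).
have [c0 [c00 Hc0]] := H 0; have [c1 [c10 Hc1]] := H 1; have [c2 [c20 Hc2]] := H 2.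
exists (C + c0 + c1 + c2); split; [by rewrite !addr_ge0|move=> x|move=> j x].
  by rewrite (le_trans (HC x))//; lra.
case: j => [[|[|[|//]]] jl].
- by rewrite (_ : Ordinal jl = 0); [have := Hc0 x; lra|exact: val_inj].
- by rewrite (_ : Ordinal jl = 1); [have := Hc1 x; lra|exact: val_inj].
- by rewrite (_ : Ordinal jl = 2); [have := Hc2 x; lra|exact: val_inj].
Qed.

Lemma test_fun_out x : ~ Om x -> ~ K x.
Proof. by case: tphi => _ _ KOm nOm /KOm. Qed.

(** The integrand is the derivative of [f * phi], which has compact support even though [f] has not;
    since that support lies in [Om], the integral may be taken over all of space. *)
Lemma sm_ibp f j : sm f ->
  (\int[leb3]_(x in Om) (f x * partial j phi x + phi x * partial j f x)%:E = 0)%E.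
Proof.
move=> smf; have [M M0 HM] := test_fun_supp.
have cK : compact K by case: tphi.
pose H x := f x * partial j phi x + phi x * partial j f x.
have HK x : ~ K x -> H x = 0.
  by move=> nK; rewrite /H test_fun_eq0// test_fun_partial_eq0// mulr0 mul0r addr0.
have cH : continuous H.
  move=> x; apply: cvgD; apply: cvgM.
  - by have [+ _] := sm_derive smf; apply.
  - exact: test_fun_continuous_partial.
  - exact: test_fun_continuous.
  - by have [+ _] := sm_derive (sm_partial j smf); apply.
have [C [C0 HC]] := continuous_supp_bounded cK cH HK.
rewrite integral_mkcond -[RHS](@integral_partial0 _ j (fun x => f x * phi x) H M C) //.
- apply: eq_integral => x _; rewrite patchE; case: ifPn => // /negP xOm.
  by rewrite HK// => /(test_fun_out _); apply => Ox; apply: xOm; exact: mem_set.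
- by move=> x; exact: (is_deriveM (sm_is_derive j x smf) (test_fun_is_derive j x)).
- move=> x i Mx; have nK := HM x i Mx.
  by rewrite HK// test_fun_eq0// mulr0.
Qed.
End test_functions.

(** * Smoothing of the positive part *)

Lemma lipschitz_derive {R : realType} (g g' : R -> R) (L a b : R) :
  (forall t, is_derive t (1 : R) g (g' t)) -> (forall t, `|g' t| <= L) ->
  `|g a - g b| <= L * `|a - b|.
Proof.
move=> dg gL; have cg : continuous g.
  by move=> t; have [d _] := dg t; exact: (differentiable_continuous ((derivable1_diffP _ _).1 d)).
have main (c d : R) : c <= d -> `|g d - g c| <= L * `|d - c|.
  move=> cd; have [e _ ->] := MVT_segment cd (fun t _ => dg t) (continuous_subspaceT cg).
  by rewrite normrM ler_wpM2r.
have [ba|ab] := leP b a; first exact: main.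
by rewrite distrC [leRHS](_ : _ = L * `|b - a|); [exact/main/ltW|rewrite distrC].
Qed.

Definition chi {R : realType} (e t : R) : R := t * flat e 0 t.
Definition chi' {R : realType} (e t : R) : R := flat e 0 t + e * flat e 1 t.

Section chi.
Context {R : realType} (e : R).
Hypothesis e0 : 0 < e.

Lemma is_derive_chi (t : R) : is_derive t (1 : R) (chi e) (chi' e t).
Proof.
have H : is_derive t (1 : R) (chi e) _ := is_deriveM (is_derive_id t (1 : R)) (is_derive_flat e0 0 t).
apply: (is_derive_eq H); rewrite /GRing.scale /= /chi' -(flatSM _ 1); ring.
Qed.

Lemma is_derive_chi' (t : R) : is_derive t (1 : R) (chi' e) (e ^+ 2 * flat e 3 t).
Proof.
have H : is_derive t (1 : R) (chi' e) _ :=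
  is_deriveD (is_derive_flat e0 0 t) (is_deriveZ e (is_derive_flat e0 1 t)).
by apply: (is_derive_eq H); rewrite /GRing.scale /=; ring.
Qed.

Lemma chi_le0 t : t <= 0 -> chi e t = 0.
Proof. by move=> t0; rewrite /chi /flat ltNge t0 mulr0. Qed.

Lemma chi'_le0 t : t <= 0 -> chi' e t = 0.
Proof. by move=> t0; rewrite /chi' /flat ltNge t0 /= mulr0 addr0. Qed.

Lemma chi'E t : 0 < t -> chi' e t = (1 + e / t) * expR (- (e / t)).
Proof. by move=> t0; rewrite /chi' /flat t0; ring. Qed.

Lemma chi'_ge0 t : 0 <= chi' e t.
Proof. by rewrite addr_ge0 ?mulr_ge0 ?flat_ge0// ltW. Qed.

Lemma chi'_le1 t : chi' e t <= 1.
Proof.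
have [t0|t0] := leP t 0; first by rewrite chi'_le0.
rewrite chi'E// expRN ler_pdivrMr ?expR_gt0// mul1r; exact: expR_ge1Dx.
Qed.

(** For [t > 0] and [s = e / t] the gap is [t (1 - exp(-s)) <= t s = e], uniformly in [t]. *)
Lemma chi_near t : `|Num.max t 0 - chi e t| <= e.
Proof.
have [t0|t0] := leP t 0; first by rewrite chi_le0// subrr normr0 ltW.
rewrite /chi /flat t0 mul1r; set s := e * t^-1.
have s0 : 0 <= s by rewrite mulr_ge0 ?invr_ge0// ltW.
have h1 : expR (- s) <= 1 by rewrite -[leRHS]expR0 ler_expR oppr_le0.
have h2 := expR_ge1Dx (- s).
have -> : t - t * expR (- s) = t * (1 - expR (- s)) by ring.
rewrite ger0_norm; last by rewrite mulr_ge0 ?subr_ge0// ltW.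
have -> : e = t * s by rewrite /s mulrCA mulfV ?mulr1// gt_eqF.
by rewrite ler_wpM2l ?(ltW t0)//; lra.
Qed.

Lemma chi_lipschitz a b : `|chi e a - chi e b| <= `|a - b|.
Proof.
rewrite -[leRHS]mul1r; apply: (lipschitz_derive _ _ is_derive_chi) => t.
by rewrite ger0_norm ?chi'_ge0// chi'_le1.
Qed.

Lemma chi'_lipschitz a b : `|chi' e a - chi' e b| <= 6 / e * `|a - b|.
Proof.
apply: (lipschitz_derive _ _ is_derive_chi') => t.
rewrite ger0_norm; last by rewrite mulr_ge0 ?flat_ge0// exprn_ge0// ltW.
(* The constant is [3!], from the bound of [flat e 3] in [flat_bounded]. *)
have -> : 6 / e = e ^+ 2 * (3`!%:R / e ^+ 3).
  by rewrite (_ : 3`! = 6)//; field; rewrite gt_eqF.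
by rewrite ler_wpM2l ?exprn_ge0 ?(ltW e0)// flat_bounded.
Qed.

Lemma sm_chi (f : R3 R -> R) : sm f -> sm (fun x => chi e (f x)).
Proof. by move=> smf; apply: sm_mul => //; apply: sm_flat. Qed.

Lemma partial_chi (f : R3 R -> R) j x : sm f ->
  partial j (fun x => chi e (f x)) x = chi' e (f x) * partial j f x.
Proof.
move=> smf; have := is_derive_comp (sm_is_derive j x smf) (is_derive_chi (f x)).
by rewrite /partial => -[_ <-].
Qed.

Lemma continuous_chi' : continuous (chi' e).
Proof.
by move=> t; have [d _] := is_derive_chi' t;
  exact: (differentiable_continuous ((derivable1_diffP _ _).1 d)).
Qed.
End chi.

(** The limit at [t = 0] is 0. This decides which everywhere defined gradient the positive part
    receives in [Sob_pos]. *)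
Lemma chi'_cvg {R : realType} (t : R) :
  (fun n => chi' (n.+1%:R^-1) t) @ \oo --> (if 0 < t then 1 else 0 : R).
Proof.
case: ifPn => [t0|]; last first.
  rewrite -leNgt => t0; under eq_fun do rewrite chi'_le0//; exact: cvg_cst.
under eq_fun do rewrite chi'E//.
have inv0 : (fun n : nat => n.+1%:R^-1 / t : R) @ \oo --> 0.
  by rewrite -[0](mul0r t^-1); apply: cvgM; [exact: cvg_harmonic|exact: cvg_cst].
have h1 : (fun n : nat => 1 + n.+1%:R^-1 / t : R) @ \oo --> (1 + 0 : R).
  by apply: cvgD => //; exact: cvg_cst.
have h2 : (fun n : nat => expR (- (n.+1%:R^-1 / t)) : R) @ \oo --> (expR (- 0) : R).
  by apply: continuous_cvg; [exact: continuous_expR|exact: cvgN].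
by have := cvgM h1 h2; rewrite oppr0 expR0 addr0 mulr1; apply.
Qed.

(* Controls the [L^1] and the [L^q] distance at once: weak derivatives pass to the limit
   by the former, the Sobolev norm is the latter. *)
Definition Psi {R : realType} (q t : R) : R := `|t| + `|t| `^ q.

Section Psi.
Context {R : realType} (q : R).
Hypothesis q1 : 1 < q.
Let q0 : 0 <= q. Proof. by rewrite (le_trans ler01)// ltW. Qed.

Lemma Psi_ge0 t : 0 <= Psi q t.
Proof. by rewrite addr_ge0 ?powR_ge0. Qed.

Lemma Psi0 : Psi q 0 = 0.
Proof. by rewrite /Psi normr0 powR0 ?addr0// gt_eqF// (lt_trans ltr01). Qed.

Lemma Psi_le s t : `|s| <= `|t| -> Psi q s <= Psi q t.
Proof. by move=> st; rewrite lerD// ge0_ler_powR ?nnegrE. Qed.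

Lemma PsiM a t : Psi q (a * t) <= (`|a| + `|a| `^ q) * Psi q t.
Proof.
rewrite /Psi normrM powRM//.
have := powR_ge0 `|a| q; have := powR_ge0 `|t| q; have := normr_ge0 a; have := normr_ge0 t.
by set x := `|t| `^ q; set y := `|a| `^ q; nra.
Qed.

(** The factor of [PsiM] at [a = 2], because [Psi (s + t) <= Psi (2 max(|s|, |t|))]. *)
Definition psic : R := 2 + 2 `^ q.

Lemma psic_gt0 : 0 < psic.
Proof. by rewrite ltr_pwDl// powR_ge0. Qed.

Lemma PsiD s t : Psi q (s + t) <= psic * (Psi q s + Psi q t).
Proof.
have main (a b : R) : `|a| <= `|b| -> Psi q (a + b) <= psic * (Psi q a + Psi q b).
  move=> ab; apply: (@le_trans _ _ (Psi q (2 * b))).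
    apply: Psi_le; rewrite normrM (ger0_norm (ler0n _ 2)).
    by apply: le_trans (ler_normD _ _) _; lra.
  apply: le_trans (PsiM _ _) _; rewrite ger0_norm// ler_wpM2l ?(ltW psic_gt0)//.
  by rewrite lerDr Psi_ge0.
have [st|/ltW ts] := leP `|s| `|t|; first exact: main.
by rewrite addrC [X in _ * X]addrC; exact: main.
Qed.

(** From [|t|^q = |t| |t|^(q-1)]. It converts uniform smallness into smallness of [Psi]; with
    [B = 1] the factor is 2. *)
Lemma Psi_lin B t : `|t| <= B -> Psi q t <= (1 + B `^ (q - 1)) * `|t|.
Proof.
move=> tB; rewrite /Psi mulrDl mul1r lerD2l -mulr_powRB1// ?(lt_trans ltr01)//.
rewrite mulrC ler_wpM2r// ge0_ler_powR// ?nnegrE ?subr_ge0 ?(ltW q1)//.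
exact: le_trans tB.
Qed.

Lemma measurable_Psi d (T : measurableType d) (D : set T) (f : T -> R) :
  measurable_fun D f -> measurable_fun D (fun x => Psi q (f x)).
Proof.
move=> mf; apply: measurable_funD.
  exact: (measurableT_comp _ mf).
by apply: (measurableT_comp (measurable_powR q)); exact: (measurableT_comp _ mf).
Qed.
End Psi.

(** * Approximation by smooth functions *)

Section integral_bounds.
Context {R : realType} (Om : set (R3 R)).
Hypothesis mOm : measurable Om.
Hypothesis fOm : (leb3 Om < +oo)%E.
Let V : R := fine (leb3 Om).

Lemma fine_leb3_ge0 : 0 <= V.
Proof. by rewrite fine_ge0. Qed.

Lemma fine_leb3 : leb3 Om = V%:E.
Proof. by rewrite fineK// ge0_fin_numE. Qed.

(** The common form of the error estimates below: a uniform error [a], and [b] times two errors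
    measured by integrals. Where there is only one such error, [G2] is taken to be 0. *)
Lemma integral_le_affine (a b e1 e2 : R) (F G1 G2 : R3 R -> R) :
  measurable_fun Om F -> measurable_fun Om G1 -> measurable_fun Om G2 ->
  0 <= a -> 0 <= b -> (forall x, 0 <= F x) -> (forall x, 0 <= G1 x) -> (forall x, 0 <= G2 x) ->
  (forall x, Om x -> F x <= a + b * (G1 x + G2 x)) ->
  (\int[leb3]_(x in Om) (G1 x)%:E <= e1%:E)%E ->
  (\int[leb3]_(x in Om) (G2 x)%:E <= e2%:E)%E ->
  (\int[leb3]_(x in Om) (F x)%:E <= (a * V + b * (e1 + e2))%:E)%E.
Proof.
move=> mF mG1 mG2 a0 b0 F0 G10 G20 FG i1 i2.
have mG : measurable_fun Om (fun x => (G1 x + G2 x)%:E).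
  by apply/measurable_EFinP; exact: measurable_funD.
apply: (@le_trans _ _ (\int[leb3]_(x in Om) (a%:E + b%:E * (G1 x + G2 x)%:E))%E).
  apply: ge0_le_integral => //.
  - by move=> x _; rewrite lee_fin.
  - exact/measurable_EFinP.
  - by apply: emeasurable_funD => //; exact: measurable_funeM.
rewrite ge0_integralD//; last 2 first.
- by move=> x _; rewrite lee_fin mulr_ge0// addr_ge0.
- exact: measurable_funeM.
rewrite integral_cst// ge0_integralZl_EFin//; last by move=> x _; rewrite lee_fin addr_ge0.
under eq_integral do rewrite EFinD.
rewrite ge0_integralD//; last 4 first.
- by move=> x _; rewrite lee_fin.
- exact/measurable_EFinP.
- by move=> x _; rewrite lee_fin.
- exact/measurable_EFinP.
rewrite fine_leb3 EFinD !EFinM leeD2l// lee_wpmul2l// ?lee_fin//.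
by rewrite EFinD leeD.
Qed.

Lemma bounded_integrable (f : R3 R -> R) (C : R) :
  measurable_fun Om f -> (forall x, Om x -> `|f x| <= C) ->
  (leb3 : {measure set (R3 R) -> \bar R}).-integrable Om (EFin \o f).
Proof.
move=> mf fC; apply: measurable_bounded_integrable => //.
by exists C; split; [exact: num_real|move=> D CD x Dx; exact: le_trans (fC x Dx) (ltW CD)].
Qed.

(** As [Om] has finite measure, the constant [K * B] is an integrable majorant. *)
Lemma Psi_dominated (q B : R) (G_ : nat -> R3 R -> R) (G : R3 R -> R) :
  1 < q -> 0 <= B ->
  (forall n, measurable_fun Om (G_ n)) -> measurable_fun Om G ->
  (forall n x, Om x -> `|G_ n x - G x| <= B) ->
  (forall x, Om x -> G_ ^~ x @ \oo --> G x) ->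
  (\int[leb3]_(x in Om) (Psi q (G x - G_ n x))%:E)%E @[n --> \oo] --> 0%E.
Proof.
move=> q1 B0 mG_ mG GB GG.
pose K := 1 + B `^ (q - 1).
have K0 : 0 <= K by rewrite addr_ge0// powR_ge0.
have PK n x : Om x -> Psi q (G x - G_ n x) <= K * `|G_ n x - G x|.
  by move=> Ox; rewrite [X in _ <= _ * X]distrC; apply: Psi_lin => //; rewrite distrC GB.
pose f_ n x := (Psi q (G x - G_ n x))%:E.
have mf_ n : measurable_fun Om (f_ n).
  by apply/measurable_EFinP/measurable_Psi/measurable_funB.
have mf : measurable_fun Om (cst 0%E : R3 R -> \bar R) by exact: measurable_cst.
have ff : {ae leb3, forall x, Om x -> f_ ^~ x @ \oo --> (0%E : \bar R)}.
  apply: aeW => x Ox; apply: cvg_EFin; first exact: nearW.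
  apply: (@squeeze_cvgr _ _ _ _ (cst 0) (fun n => K * `|G_ n x - G x|)).
  - by apply: nearW => n; rewrite /f_ /= Psi_ge0 PK.
  - exact: cvg_cst.
  - rewrite -[X in _ --> X](mulr0 K); apply: cvgM; first exact: cvg_cst.
    by rewrite -(normr0 R); apply: cvg_norm; rewrite -(subrr (G x)); apply: cvgB;
      [exact: GG|exact: cvg_cst].
have ig : (leb3 : {measure set (R3 R) -> \bar R}).-integrable Om (cst (K * B)%:E).
  apply: (@bounded_integrable (cst (K * B)) (K * B)); first exact: measurable_cst.
  by move=> x _; rewrite ger0_norm// mulr_ge0.
have fg : {ae leb3, forall x n, Om x -> (`|f_ n x| <= cst (K * B)%:E x)%E}.
  apply: aeW => x n Ox; rewrite /f_ /= lee_fin ger0_norm ?Psi_ge0//.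
  by apply: le_trans (PK n x Ox) _; rewrite ler_wpM2l// GB.
have [_ _] := dominated_convergence mOm mf_ mf ff ig fg.
by rewrite integral0.
Qed.

Lemma Psi_dominated_small (q B d : R) (G_ : nat -> 'I_3 -> R3 R -> R) (G : 'I_3 -> R3 R -> R) :
  1 < q -> 0 < d ->
  (forall n j, measurable_fun setT (G_ n j)) -> (forall j, measurable_fun setT (G j)) ->
  (forall n j x, `|G_ n j x| <= B) -> (forall j x, `|G j x| <= B) ->
  (forall j x, G_ ^~ j ^~ x @ \oo --> G j x) ->
  exists N, forall n, (N <= n)%N -> forall j,
    (\int[leb3]_(x in Om) (Psi q (G j x - G_ n j x))%:E <= d%:E)%E.
Proof.
move=> q1 d0 mG_ mG G_B GB GG.
have B0 : 0 <= 2 * B by rewrite mulr_ge0// (le_trans _ (GB 0 (0, 0, 0))).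
have H j : exists N, forall n, (N <= n)%N ->
    (\int[leb3]_(x in Om) (Psi q (G j x - G_ n j x))%:E <= d%:E)%E.
  have C : (\int[leb3]_(x in Om) (Psi q (G j x - G_ n j x))%:E)%E @[n --> \oo] --> 0%E.
    apply: (Psi_dominated q1 B0).
    - by move=> n; exact: measurable_funTS.
    - exact: measurable_funTS.
    - move=> n x _; apply: le_trans (ler_normB _ _) _.
      by have := G_B n j x; have := GB j x; lra.
    - by move=> x _; exact: GG.
  have [N _ HN] : \forall n \near \oo,
      (\int[leb3]_(x in Om) (Psi q (G j x - G_ n j x))%:E < d%:E)%E.
    apply: (C [set y | (y < d%:E)%E]); apply: open_nbhs_nbhs; split; first exact: open_ereal_lt_ereal.
    by rewrite /= lte_fin.
  by exists N => n Nn; apply: ltW; exact: HN.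
have [n0 H0] := H 0; have [n1 H1] := H 1; have [n2 H2] := H 2.
exists (maxn n0 (maxn n1 n2)) => n; rewrite !geq_max => /and3P[? ? ?] j.
case: j => [[|[|[|//]]] jl].
- by rewrite (_ : Ordinal jl = 0); [exact: H0|exact: val_inj].
- by rewrite (_ : Ordinal jl = 1); [exact: H1|exact: val_inj].
- by rewrite (_ : Ordinal jl = 2); [exact: H2|exact: val_inj].
Qed.
End integral_bounds.

(* The approximation of [u] is uniform on all of [R^3], which is what allows
   [Sob_zero_trace] to produce approximants with compact support. *)
Definition Sob {R : realType} (q : R) (Om : set (R3 R)) (u : R3 R -> R)
    (G : 'I_3 -> R3 R -> R) : Prop :=
  [/\ measurable_fun setT u, forall j, measurable_fun setT (G j),
     exists2 C, 0 <= C & forall j x, `|G j x| <= C &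
     forall eps, 0 < eps -> exists f, [/\ sm f, forall x, `|u x - f x| <= eps &
       forall j, (\int[leb3]_(x in Om) (Psi q (G j x - partial j f x))%:E <= eps%:E)%E]].

Section sobolev.
Context {R : realType} (q : R) (Om : set (R3 R)).
Hypothesis q1 : 1 < q.
Hypothesis mOm : measurable Om.
Hypothesis fOm : (leb3 Om < +oo)%E.
Let V : R := fine (leb3 Om).
Let V0 : 0 <= V := fine_leb3_ge0 Om.

Let mPsi (f : R3 R -> R) : measurable_fun setT f -> measurable_fun Om (fun x => Psi q (f x)).
Proof. by move=> mf; apply/measurable_Psi/measurable_funTS. Qed.

Let mpartial (f : R3 R -> R) j : sm f -> measurable_fun setT (partial j f).
Proof. by move=> smf; apply: sm_measurable; exact: sm_partial. Qed.

Lemma Sob_sm f C : sm f -> (forall j x, `|partial j f x| <= C) -> Sob q Om f (fun j => partial j f).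
Proof.
move=> smf fC; split; first exact: sm_measurable.
- by move=> j; exact: mpartial.
- exists (Num.max 0 C) => [|j x]; first by rewrite le_max lexx.
  by rewrite le_max fC orbT.
- move=> e e0; exists f; split => // [x|j]; first by rewrite subrr normr0 ltW.
  by under eq_integral do rewrite subrr Psi0//; rewrite integral0 lee_fin ltW.
Qed.

(** An approximant of a late [u_ n] also approximates [u]. The functions must converge uniformly,
    but for the gradients pointwise convergence and a common bound suffice, by dominated
    convergence. *)
Lemma Sob_limit (u_ : nat -> R3 R -> R) (G_ : nat -> 'I_3 -> R3 R -> R) u G (B : R) :
  (forall n, Sob q Om (u_ n) (G_ n)) ->
  (forall n j x, `|G_ n j x| <= B) ->
  (forall e, 0 < e -> exists N, forall n x, (N <= n)%N -> `|u x - u_ n x| <= e) ->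
  (forall j x, (fun n => G_ n j x) @ \oo --> G j x) ->
  Sob q Om u G.
Proof.
move=> S GB uu GG.
have mG j : measurable_fun setT (G j).
  by apply: (@measurable_fun_cvg _ _ _ setT (fun n => G_ n j)) => [m|x _]; [case: (S m)|exact: GG].
have B0 : 0 <= B by exact: le_trans (GB 0%N 0 (0, 0, 0)).
have GB' j x : `|G j x| <= B.
  have gc : (fun n => `|G_ n j x|) @ \oo --> `|G j x| by apply: cvg_norm; exact: GG.
  rewrite -(cvg_lim _ gc)//; apply: limr_le; last exact: nearW.
  by apply/cvg_ex; eexists; exact: gc.
split => //; last 2 first.
- by exists B.
(* Two gradient errors of size [d] are combined by [PsiD], hence the factor [2 * psic q]. *)
- move=> e e0; pose d := e / (2 * psic q + 1).
  have c0 : 0 < psic q := psic_gt0 q.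
  have d0 : 0 < d by rewrite divr_gt0// ltr_wpDl// mulr_ge0// ltW.
  have de : psic q * (d + d) <= e.
    have dE : d * (2 * psic q + 1) = e by rewrite divfK// gt_eqF// ltr_wpDl// mulr_ge0// ltW.
    rewrite -dE; move: (psic q) => c.
    by rewrite (_ : d * (2 * c + 1) = c * (d + d) + d); [rewrite lerDl ltW|ring].
  have [N1 HN1] := uu (e / 2) ltac:(by rewrite divr_gt0).
  have mG_ n k : measurable_fun setT (G_ n k) by case: (S n).
  have [N2 HN2] := Psi_dominated_small mOm fOm q1 d0 mG_ mG GB GB' GG.
  pose n := maxn N1 N2.
  have [_ mGn _ /(_ (Num.min d (e / 2)))] := S n.
  rewrite lt_min d0 divr_gt0// => /(_ isT) [f [smf fu fG]].
  exists f; split => // [x|j].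
    rewrite (_ : u x - f x = (u x - u_ n x) + (u_ n x - f x)); last ring.
    rewrite (le_trans (ler_normD _ _))// (splitr e) lerD//; first by rewrite HN1// leq_maxl.
    by rewrite (le_trans (fu x))// ge_min lexx orbT.
  apply: (@le_trans _ _ (0 * V + psic q * (d + d))%:E); last by rewrite mul0r add0r lee_fin.
  apply: (integral_le_affine mOm fOm (G1 := fun x => Psi q (G j x - G_ n j x))
    (G2 := fun x => Psi q (G_ n j x - partial j f x))) => //; try by move=> *; exact: Psi_ge0.
  + by apply: mPsi; apply: measurable_funB => //; exact: mpartial.
  + by apply: mPsi; apply: measurable_funB.
  + by apply: mPsi; apply: measurable_funB => //; exact: mpartial.
  + exact: ltW.
  + move=> x _; rewrite add0r (_ : G j x - partial j f x = (G j x - G_ n j x) + (G_ n j x - partial j f x)); last ring.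
    exact: PsiD.
  + by apply: HN2; exact: leq_maxr.
  + by apply: le_trans (fG j) _; rewrite lee_fin ge_min lexx.
- apply: (@measurable_fun_cvg _ _ _ setT (fun n => u_ n)) => [m|x _]; first by case: (S m).
  apply/cvgrPdist_le => e e0; have [N HN] := uu e e0.
  by exists N => // n Nn; exact: HN.
Qed.
End sobolev.

(** Chooses the tolerances below: [A] collects the coefficients with which [d] enters the final
    estimates. *)
Lemma ex_small {R : realType} (A e : R) : 0 <= A -> 0 < e -> exists2 d, 0 < d & A * d <= e.
Proof.
move=> A0 e0; have A1 : 0 < A + 1 by rewrite ltr_wpDl.
exists (e / (A + 1)); first exact: divr_gt0.
by rewrite mulrA ler_pdivrMr// mulrC ler_pM2l// lerDl.
Qed.

(** * Stability of approximability under algebraic and lattice operations *)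

Section sobolev_closure.
Context {R : realType} (q : R) (Om : set (R3 R)).
Hypothesis q1 : 1 < q.
Hypothesis mOm : measurable Om.
Hypothesis fOm : (leb3 Om < +oo)%E.
Let V : R := fine (leb3 Om).
Let V0 : 0 <= V := fine_leb3_ge0 Om.
Let c0 : 0 < psic q := psic_gt0 q.

Let mPsi (f : R3 R -> R) : measurable_fun setT f -> measurable_fun Om (fun x => Psi q (f x)).
Proof. by move=> mf; apply/measurable_Psi/measurable_funTS. Qed.

Let mpartial (f : R3 R -> R) j : sm f -> measurable_fun setT (partial j f).
Proof. by move=> smf; apply: sm_measurable; exact: sm_partial. Qed.

Lemma partial_add (f g : R3 R -> R) j x : sm f -> sm g ->
  partial j (fun y => f y + g y) x = partial j f x + partial j g x.
Proof.
by move=> sf sg; have [_ E] := is_deriveD (sm_is_derive j x sf) (sm_is_derive j x sg); exact: E.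
Qed.

Lemma partial_scale (a : R) (f : R3 R -> R) j x : sm f ->
  partial j (fun y => a * f y) x = a * partial j f x.
Proof. by move=> sf; have [_ E] := is_deriveZ a (sm_is_derive j x sf); exact: E. Qed.

Lemma Sob_add u G v H : Sob q Om u G -> Sob q Om v H ->
  Sob q Om (fun x => u x + v x) (fun j x => G j x + H j x).
Proof.
move=> [mu mG [C C0 GC] Su] [mv mH [D D0 HD] Sv]; split.
- exact: measurable_funD.
- by move=> j; exact: measurable_funD.
- exists (C + D) => [|j x]; first exact: addr_ge0.
  by rewrite (le_trans (ler_normD _ _))// lerD.
- move=> e e0; have [d d0 dle] : exists2 d, 0 < d & (2 + 2 * psic q) * d <= e.
    by apply: ex_small => //; rewrite addr_ge0// mulr_ge0// ltW.
  have cd0 : 0 <= psic q * d by rewrite mulr_ge0// ltW.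
  have [f [sf uf Gf]] := Su d d0; have [g [sg vg Hg]] := Sv d d0.
  exists (fun x => f x + g x); split; [exact: sm_add|move=> x|move=> j].
    rewrite (_ : _ - _ = (u x - f x) + (v x - g x)); last ring.
    by rewrite (le_trans (ler_normD _ _))//; have := uf x; have := vg x; lra.
  apply: (@le_trans _ _ (0 * V + psic q * (d + d))%:E); last by rewrite lee_fin; lra.
  apply: (integral_le_affine mOm fOm (G1 := fun x => Psi q (G j x - partial j f x))
    (G2 := fun x => Psi q (H j x - partial j g x))) => //; try by move=> *; exact: Psi_ge0.
  + apply: mPsi; apply: measurable_funB; first exact: measurable_funD.
    by apply: mpartial; exact: sm_add.
  + by apply: mPsi; apply: measurable_funB => //; exact: mpartial.
  + by apply: mPsi; apply: measurable_funB => //; exact: mpartial.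
  + exact: ltW.
  + move=> x _; rewrite add0r partial_add//.
    rewrite (_ : _ - _ = (G j x - partial j f x) + (H j x - partial j g x)); last ring.
    exact: PsiD.
Qed.

Lemma Sob_scale a u G : Sob q Om u G -> Sob q Om (fun x => a * u x) (fun j x => a * G j x).
Proof.
move=> [mu mG [C C0 GC] Su]; split.
- by apply: measurable_funM.
- by move=> j; apply: measurable_funM.
- exists (`|a| * C) => [|j x]; first exact: mulr_ge0.
  by rewrite normrM ler_wpM2l.
- pose K := `|a| + `|a| `^ q; have K0 : 0 <= K by rewrite addr_ge0// powR_ge0.
  move=> e e0; have [d d0 dle] : exists2 d, 0 < d & (`|a| + K) * d <= e.
    by apply: ex_small => //; rewrite addr_ge0.
  have ad0 : 0 <= `|a| * d by rewrite mulr_ge0// ltW.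
  have Kd0 : 0 <= K * d by rewrite mulr_ge0// ltW.
  have [f [sf uf Gf]] := Su d d0.
  exists (fun x => a * f x); split; [by apply: sm_mul => //; exact: sm_cst|move=> x|move=> j].
    rewrite -mulrBr normrM; apply: (@le_trans _ _ (`|a| * d)); last by lra.
    by rewrite ler_wpM2l.
  apply: (@le_trans _ _ (0 * V + K * (d + 0))%:E); last by rewrite lee_fin; lra.
  apply: (integral_le_affine mOm fOm (G1 := fun x => Psi q (G j x - partial j f x))
    (G2 := fun=> 0)) => //; try by move=> *; exact: Psi_ge0.
  + apply: mPsi; apply: measurable_funB; first exact: measurable_funM.
    by apply: mpartial; apply: sm_mul => //; exact: sm_cst.
  + by apply: mPsi; apply: measurable_funB => //; exact: mpartial.
  + by move=> x _; rewrite add0r addr0 partial_scale// -mulrBr PsiM.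
  + by rewrite integral0.
Qed.

(** Separate from [Sob_chi] because [Sob_zero_trace] needs an approximant of the form [chi e (f x)]
    with [f] itself uniformly close to [u]: this is what controls its support. *)
Lemma Sob_chi_approx e u G eps : 0 < e -> 0 < eps -> Sob q Om u G ->
  exists f, [/\ sm f, forall x, `|u x - f x| <= eps & forall j,
    (\int[leb3]_(x in Om) (Psi q (chi' e (u x) * G j x -
      partial j (fun y => chi e (f y)) x))%:E <= eps%:E)%E].
Proof.
move=> e0 eps0 [mu mG [C C0 GC] Su].
have mchi' (f : R3 R -> R) : measurable_fun setT f -> measurable_fun setT (fun x => chi' e (f x)).
  move=> mf; apply: (measurableT_comp (f := chi' e) _ mf).
  by apply: continuous_measurable_fun; exact: continuous_chi'.
pose L := 6 / e * C; have L0 : 0 <= L by rewrite mulr_ge0// divr_ge0// ltW.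
have cLV0 : 0 <= psic q * (2 * L) * V.
  by apply: mulr_ge0 => //; apply: mulr_ge0; [exact: ltW|exact: mulr_ge0].
(* The minimum with 1 gives [L * d <= 1], so that [Psi_lin] bounds [Psi q (L * d)] by
   [2 * L * d]. *)
have [d d0 dle] : exists2 d, 0 < d &
    (1 + L + psic q * (2 * L) * V + psic q) * d <= Num.min 1 eps.
  by apply: ex_small; [have := ltW c0; lra|rewrite lt_min ltr01].
have Ld0 : 0 <= L * d by rewrite mulr_ge0// ltW.
have cLVd0 : 0 <= psic q * (2 * L) * V * d by rewrite mulr_ge0// ltW.
have cd0 : 0 <= psic q * d by rewrite mulr_ge0// ltW.
move: dle; rewrite le_min => /andP[dle1 dle2].
have [f [sf uf Gf]] := Su d d0.
exists f; split => // [x|j]; first by rewrite (le_trans (uf x))//; lra.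
apply: (@le_trans _ _ (psic q * Psi q (L * d) * V + psic q * (d + 0))%:E).
  apply: (integral_le_affine mOm fOm (G1 := fun x => Psi q (G j x - partial j f x))
    (G2 := fun=> 0)) => //; try by move=> *; exact: Psi_ge0.
  + apply: mPsi; apply: measurable_funB; last by apply: mpartial; exact: sm_chi.
    by apply: measurable_funM => //; exact: mchi'.
  + by apply: mPsi; apply: measurable_funB => //; exact: mpartial.
  + by rewrite mulr_ge0 ?Psi_ge0// ltW.
  + exact: ltW.
  + move=> x _; rewrite addr0 -mulrDr partial_chi//.
    have -> : Psi q (G j x - partial j f x) = Psi q `|G j x - partial j f x|.
      by rewrite /Psi normr_id.
    apply: le_trans (PsiD q1 _ _); apply: Psi_le => //.
    rewrite [leRHS]ger0_norm ?addr_ge0//.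
    (* The first summand is uniformly small, since [chi' e] is Lipschitz and [G] is bounded; the
       second is controlled by the gradient error of [f], since [chi' e] has values in [0, 1]. *)
    rewrite (_ : chi' e (u x) * G j x - _ = (chi' e (u x) - chi' e (f x)) * G j x +
      chi' e (f x) * (G j x - partial j f x)); last ring.
    rewrite (le_trans (ler_normD _ _))// !normrM lerD//.
      rewrite (_ : L * d = 6 / e * d * C); last by rewrite /L mulrAC.
      rewrite ler_pM//; apply: le_trans (chi'_lipschitz e0 _ _) _.
      by rewrite ler_wpM2l// divr_ge0// ltW.
    by rewrite (ger0_norm (chi'_ge0 e0 _)) ler_piMl// chi'_le1.
  + by rewrite integral0.
rewrite lee_fin addr0; apply: le_trans dle2.
have : psic q * Psi q (L * d) * V <= psic q * (2 * L * d) * V.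
  rewrite ler_wpM2r// ler_wpM2l ?(ltW c0)//.
  have Ld1 : `|L * d| <= 1 by rewrite ger0_norm//; lra.
  by apply: le_trans (Psi_lin q1 Ld1) _; rewrite powR1 ger0_norm//; lra.
lra.
Qed.

Lemma Sob_chi e u G : 0 < e -> Sob q Om u G ->
  Sob q Om (fun x => chi e (u x)) (fun j x => chi' e (u x) * G j x).
Proof.
move=> e0 S; have [mu mG [C C0 GC] _] := S.
have mchi' (f : R3 R -> R) : measurable_fun setT f -> measurable_fun setT (fun x => chi' e (f x)).
  move=> mf; apply: (measurableT_comp (f := chi' e) _ mf).
  by apply: continuous_measurable_fun; exact: continuous_chi'.
split.
- apply: (measurableT_comp (f := chi e) _ mu); apply: continuous_measurable_fun => t.
  have [d _] := is_derive_chi e0 t.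
  exact: (differentiable_continuous ((derivable1_diffP _ _).1 d)).
- by move=> j; apply: measurable_funM => //; exact: mchi'.
- exists C => // j x; rewrite normrM ger0_norm ?chi'_ge0// -[leRHS]mul1r.
  by rewrite ler_pM// ?chi'_ge0// chi'_le1.
- move=> eps eps0; have [f [sf uf Gf]] := Sob_chi_approx e0 eps0 S.
  exists (fun x => chi e (f x)); split => // [|x]; first exact: sm_chi.
  exact: le_trans (chi_lipschitz e0 _ _) (uf x).
Qed.

Lemma Sob_pos u G : Sob q Om u G ->
  Sob q Om (fun x => Num.max (u x) 0) (fun j x => if 0 < u x then G j x else 0).
Proof.
move=> S; have [_ _ [C C0 GC] _] := S.
have n0 n : 0 < n.+1%:R^-1 :> R by rewrite invr_gt0.
apply: (Sob_limit q1 mOm fOm (u_ := fun n x => chi n.+1%:R^-1 (u x))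
  (G_ := fun n j x => chi' n.+1%:R^-1 (u x) * G j x) (B := C)).
- by move=> n; exact: Sob_chi.
- move=> n j x; rewrite normrM ger0_norm ?chi'_ge0// -[leRHS]mul1r.
  by rewrite ler_pM// ?chi'_ge0// chi'_le1.
- move=> e e0; have [N _ HN] := near_infty_natSinv_lt (PosNum e0).
  exists N => n x Nn; apply: le_trans (chi_near (n0 n) _) _.
  by apply: ltW; exact: HN.
- move=> j x; have := cvgM (chi'_cvg (t := u x)) (cvg_cst (G j x)).
  by case: ifP => _; rewrite ?mul1r ?mul0r; apply.
Qed.

Lemma Sob_eq u G v H : Sob q Om u G -> (forall x, v x = u x) -> (forall j x, H j x = G j x) ->
  Sob q Om v H.
Proof.
move=> S vu HG; have -> : v = u by exact/funext.
by have -> : H = G by apply/funext => j; exact/funext.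
Qed.

(** [max(u, v) = v + max(u - v, 0)]; a tie selects the gradient of [v]. *)
Lemma Sob_max u G v H : Sob q Om u G -> Sob q Om v H ->
  Sob q Om (fun x => Num.max (u x) (v x)) (fun j x => if v x < u x then G j x else H j x).
Proof.
move=> Su Sv; have S := Sob_add Sv (Sob_pos (Sob_add Su (Sob_scale (-1) Sv))).
apply: (Sob_eq S) => [x|j x] /=; rewrite !mulN1r.
  by have [?|?] := leP (u x) (v x); have [?|?] := leP (u x - v x) 0; lra.
by rewrite subr_gt0; case: ifP => _; ring.
Qed.

(** [min(u, v) = u - max(u - v, 0)]; a tie selects the gradient of [u]. *)
Lemma Sob_min u G v H : Sob q Om u G -> Sob q Om v H ->
  Sob q Om (fun x => Num.min (u x) (v x)) (fun j x => if v x < u x then H j x else G j x).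
Proof.
move=> Su Sv; have S := Sob_add Su (Sob_scale (-1) (Sob_pos (Sob_add Su (Sob_scale (-1) Sv)))).
apply: (Sob_eq S) => [x|j x] /=; rewrite !mulN1r.
  by have [?|?] := leP (u x) (v x); have [?|?] := leP (u x - v x) 0; lra.
by rewrite subr_gt0; case: ifP => _; ring.
Qed.

Lemma Sob_cst a : Sob q Om (fun=> a) (fun _ _ => 0).
Proof.
apply: (Sob_eq (G := fun j => partial j (fun=> a)) (u := fun=> a)) => [|//|j x].
  apply: (Sob_sm _ _ (C := 0)) => // [|j x]; first exact: sm_cst.
  by rewrite /partial derive_cst normr0.
by rewrite /partial derive_cst.
Qed.

Lemma Sob_crd i : Sob q Om (crd i) (fun j _ => (i == j)%:R).
Proof.
have pE j x : partial j (crd i : R3 R -> R) x = (i == j)%:R by have [_ <-] := is_derive_crd i j x.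
apply: (Sob_eq (G := fun j => partial j (crd i)) (u := crd i)) => [|//|j x].
  apply: (Sob_sm _ _ (C := 1)) => // [|j x]; first exact: sm_crd.
  by rewrite pE normr_nat lern1 leq_b1.
by rewrite pE.
Qed.
End sobolev_closure.

(** * Weak derivatives and compactly supported approximants *)

Section sobolev_zero_trace.
Context {R : realType} (q : R) (Om : set (R3 R)).
Hypothesis q1 : 1 < q.
Hypothesis mOm : measurable Om.
Hypothesis fOm : (leb3 Om < +oo)%E.
Let V : R := fine (leb3 Om).
Let V0 : 0 <= V := fine_leb3_ge0 Om.
Let c0 : 0 < psic q := psic_gt0 q.

(** [J] is the defect of the identity. For a smooth approximant the defect is zero by [sm_ibp], and
    passing from it to [u] costs at most a fixed multiple of [e]. *)
Lemma Sob_weak u G phi j : Sob q Om u G -> test_fun Om phi ->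
  (\int[leb3]_(x in Om) (u x * partial j phi x)%:E =
   - \int[leb3]_(x in Om) (G j x * phi x)%:E)%E.
Proof.
move=> [mu mG [C C0 GC] Su] tphi.
have [D [D0 phiD dphiD]] := test_fun_bounded tphi.
have cK : compact (closure [set x | phi x != 0]) by case: tphi.
have mphi : measurable_fun setT phi := continuous_measurable3 (test_fun_continuous tphi).
have mdphi : measurable_fun setT (partial j phi) :=
  continuous_measurable3 (@test_fun_continuous_partial _ _ _ tphi j).
pose A x := u x * partial j phi x; pose B x := G j x * phi x.
have intB : (leb3 : {measure set (R3 R) -> \bar R}).-integrable Om (EFin \o B).
  apply: (bounded_integrable mOm fOm (C := C * D)).
    by apply: measurable_funTS; exact: measurable_funM.
  by move=> x _; rewrite normrM ler_pM.
have intfd f : sm f -> exists2 E, 0 <= E & forall x, `|f x * partial j phi x| <= E.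
  move=> sf; have [E [E0 HE]] : exists E, 0 <= E /\ forall x, `|f x * partial j phi x| <= E.
    apply: (continuous_supp_bounded cK) => [x|x nK].
      apply: cvgM; last exact: (test_fun_continuous_partial tphi).
      by have [+ _] := sm_derive sf; apply.
    by rewrite (test_fun_partial_eq0 _ nK) mulr0.
  by exists E.
have intpf f : sm f -> exists2 E, 0 <= E & forall x, `|phi x * partial j f x| <= E.
  move=> sf; have [E [E0 HE]] : exists E, 0 <= E /\ forall x, `|phi x * partial j f x| <= E.
    apply: (continuous_supp_bounded cK) => [x|x nK].
      apply: cvgM; first exact: (test_fun_continuous tphi).
      by have [+ _] := sm_derive (sm_partial j sf); apply.
    by rewrite (test_fun_eq0 nK) mul0r.
  by exists E.
(* [u] may be unbounded, but it is within 1 of a smooth function, which is bounded on the support of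
   [phi]. *)
have intA : (leb3 : {measure set (R3 R) -> \bar R}).-integrable Om (EFin \o A).
  have [f [sf uf _]] := Su 1 ltr01; have [E E0 HE] := intfd f sf.
  apply: (bounded_integrable mOm fOm (C := D + E)).
    by apply: measurable_funTS; exact: measurable_funM.
  move=> x _; rewrite /A (_ : _ * _ = (u x - f x) * partial j phi x + f x * partial j phi x); last ring.
  rewrite (le_trans (ler_normD _ _))// lerD// normrM -[leRHS]mul1r.
  by rewrite ler_pM.
pose J := (\int[leb3]_(x in Om) (A x + B x)%:E)%E.
have JE : J = (\int[leb3]_(x in Om) (A x)%:E + \int[leb3]_(x in Om) (B x)%:E)%E.
  by rewrite /J; under eq_integral do rewrite EFinD; exact: integralD.
suff J0 : J = 0%E.
  have fB := integrable_fin_num mOm intB.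
  by rewrite -/(A _) -[LHS](addeK _ fB) -JE J0 add0e.
have key e : 0 < e -> (`|J| <= (D * (V + 1) * e)%:E)%E.
  move=> e0; have [f [sf uf Gf]] := Su e e0.
  have [E1 E10 HE1] := intfd f sf; have [E2 E20 HE2] := intpf f sf.
  have mf := sm_measurable sf; have mpf := sm_measurable (sm_partial j sf).
  pose H x := f x * partial j phi x + phi x * partial j f x.
  have mH : measurable_fun setT H.
    by apply: measurable_funD; exact: measurable_funM.
  have mAB : measurable_fun setT (fun x => A x + B x).
    by apply: measurable_funD; exact: measurable_funM.
  have intH : (leb3 : {measure set (R3 R) -> \bar R}).-integrable Om (EFin \o H).
    apply: (bounded_integrable mOm fOm (C := E1 + E2)); first exact: measurable_funTS.
    by move=> x _; rewrite (le_trans (ler_normD _ _))// lerD.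
  have -> : J = (\int[leb3]_(x in Om) (A x + B x - H x)%:E)%E.
    under [RHS]eq_integral do rewrite EFinB.
    rewrite integralB_EFin//; last by exact: (integrableD mOm intA intB).
    by rewrite (sm_ibp tphi j sf) sube0.
  apply: le_trans (le_abse_integral _ mOm _) _.
    by apply/measurable_EFinP/measurable_funTS/measurable_funB.
  (* The uniform error [e] against [|partial j phi| <= D] contributes [D * e * V]; the gradient
     error against [|phi| <= D] contributes [D * e]. *)
  have := @integral_le_affine R Om mOm fOm (D * e) D e 0 (fun x => `|A x + B x - H x|)
    (fun x => Psi q (G j x - partial j f x)) (fun=> 0).
  rewrite addr0 (_ : D * (V + 1) * e = D * e * V + D * e); last ring.
  apply => //.
  - by apply/measurableT_comp => //; apply/measurable_funTS/measurable_funB.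
  - by apply: measurable_Psi; apply: measurable_funTS; exact: measurable_funB.
  - by rewrite mulr_ge0// ltW.
  - by move=> x; exact: Psi_ge0.
  - move=> x _; rewrite addr0 (_ : _ - _ = (u x - f x) * partial j phi x +
      (G j x - partial j f x) * phi x); last by rewrite /A /B /H; ring.
    rewrite (le_trans (ler_normD _ _))// !normrM lerD//.
      by rewrite mulrC ler_pM.
    by rewrite mulrC ler_pM// lerDl powR_ge0.
  - by rewrite integral0.
have Jf : J \is a fin_num.
  rewrite JE fin_numD (integrable_fin_num mOm intA) (integrable_fin_num mOm intB)//.
move: key; rewrite -(fineK Jf); move: (fine J) => r key.
congr EFin; apply/eqP; rewrite -normr_eq0; apply/negPn/negP => r0.
have rp : 0 < `|r| by rewrite lt_def r0 normr_ge0.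
have [d d0] : exists2 d, 0 < d & D * (V + 1) * d <= `|r| / 2.
  by apply: ex_small; [rewrite mulr_ge0// addr_ge0|rewrite divr_gt0].
by have := key d d0; rewrite lee_fin; lra.
Qed.

(* If [f] is uniformly [e/2]-close to [u - e], then [chi e f] vanishes wherever [u <= e/2]. *)
Lemma Sob_zero_trace u G (K : set (R3 R)) eps : Sob q Om u G ->
  compact K -> K `<=` Om -> (forall x, 0 < u x -> K x) ->
  (forall x, 0 <= u x) -> (forall x, u x <= 0 -> forall j, G j x = 0) -> 0 < eps ->
  exists f, [/\ test_fun Om f, sm f,
    (\int[leb3]_(x in Om) (Psi q (u x - f x))%:E <= eps%:E)%E &
    forall j, (\int[leb3]_(x in Om) (Psi q (G j x - partial j f x))%:E <= eps%:E)%E].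
Proof.
move=> S cK KOm uK u0 G0 eps0; have [mu mG [C C0 GC] _] := S.
pose r n : R := n.+1%:R^-1.
have r0 n : 0 < r n by rewrite invr_gt0.
have Sr n : Sob q Om (fun x => u x + - r n) G.
  have S2 := Sob_add q1 mOm fOm S (Sob_cst Om q1 (- r n)).
  by apply: (Sob_eq S2) => // j x; rewrite addr0.
pose G_ n j x := chi' (r n) (u x + - r n) * G j x.
have rcvg : r @ \oo --> (0 : R) by exact: cvg_harmonic.
have [d d0 dle] : exists2 d, 0 < d & (2 * psic q + 6 * V + 4) * d <= Num.min 1 eps.
  by apply: ex_small; [rewrite !addr_ge0 ?mulr_ge0 ?(ltW c0)|rewrite lt_min ltr01].
have cd0 : 0 <= psic q * d by rewrite mulr_ge0// ltW.
have Vd0 : 0 <= V * d by rewrite mulr_ge0// ltW.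
move: dle; rewrite le_min => /andP[dle1 dle2].
have [N1 HN1] : exists N, forall n, (N <= n)%N -> forall j,
    (\int[leb3]_(x in Om) (Psi q (G j x - G_ n j x))%:E <= d%:E)%E.
  apply: (Psi_dominated_small mOm fOm q1 d0 _ mG _ GC) => [n j|n j x|j x].
  - by have [_ + _ _] := Sob_chi q1 mOm fOm (r0 n) (Sr n); apply.
  - rewrite normrM ger0_norm ?chi'_ge0// -[leRHS]mul1r.
    by rewrite ler_pM// ?chi'_ge0// chi'_le1.
  (* Where [u x = 0] the shifted argument is negative and [G_ n j x = 0] for every [n]; convergence
     there is exactly the hypothesis that [G] vanishes. *)
  - have [up|ux] := ltP 0 (u x); last first.
      by rewrite /G_ G0//; under eq_fun do rewrite mulr0; exact: cvg_cst.
    rewrite -[X in _ --> X]mul1r; apply: cvgM; last exact: cvg_cst.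
    pose s n := r n / (u x + - r n).
    have ucvg : (fun n => u x + - r n) @ \oo --> u x.
      by rewrite -[X in _ --> X]subr0; apply: cvgB => //; exact: cvg_cst.
    have scvg : s @ \oo --> (0 / u x : R).
      by apply: cvgM => //; apply: cvgV => //; rewrite gt_eqF.
    have h1 : (fun n => 1 + s n) @ \oo --> (1 + 0 / u x : R).
      by apply: cvgD => //; exact: cvg_cst.
    have h2 : (fun n => expR (- s n)) @ \oo --> (expR (- (0 / u x)) : R).
      by apply: continuous_cvg; [exact: continuous_expR|exact: cvgN].
    have h3 : (fun n => (1 + s n) * expR (- s n)) @ \oo --> (1 : R).
      by have := cvgM h1 h2; rewrite mul0r oppr0 expR0 addr0 mulr1; apply.
    have h4 : (fun n => chi' (r n) (u x + - r n)) @ \oo --> (1 : R).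
      apply: cvg_trans h3; apply: near_eq_cvg; near=> n; rewrite chi'E//.
      by near: n; apply: (cvgr_gt _ ucvg).
    exact: h4.
have [N2 _ HN2] := near_infty_natSinv_lt (PosNum d0).
pose n := maxn N1 N2; have rd : r n < d by apply: HN2; rewrite /= leq_maxr.
have r2 : 0 < Num.min d (r n / 2) by rewrite lt_min d0 divr_gt0.
have [f [sf uf Gf]] := Sob_chi_approx q1 mOm fOm (r0 n) r2 (Sr n).
exists (fun x => chi (r n) (f x)).
have sg : sm (fun x => chi (r n) (f x)) by exact: sm_chi.
have cf : continuous f by have [] := sm_derive sf.
(* The closed set [0 <= f] contains the support, and on it [u >= r n / 2 > 0], which forces
   membership in [K]. *)
have supp : closure [set x | chi (r n) (f x) != 0] `<=` K.
  have cl : closed [set x | 0 <= f x].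
    apply: (@preimage_closed _ _ f [set t : R | 0 <= t]) => //; exact: closed_ge.
  move=> x /(closureS (B := [set x | 0 <= f x])) H; apply: uK.
  have /H : [set x | chi (r n) (f x) != 0] `<=` [set x | 0 <= f x].
    by move=> y /=; apply: contraNT; rewrite -ltNge => /ltW fy; rewrite chi_le0.
  rewrite -(closure_id _).1// => fx.
  by have := uf x; rewrite le_min => /andP[_]; rewrite ler_norml; have := r0 n; move: fx; rewrite /=; lra.
split => //.
- split; [exact: sm_smooth|exact: subclosed_compact (@closed_closure _ _) cK supp|].
  exact: subset_trans supp KOm.
(* Shift, smoothing and approximation each cost at most [d]; [Psi_lin] doubles the total [3 * d]. *)
- apply: (@le_trans _ _ (6 * d * V + 0 * (0 + 0))%:E); last by rewrite lee_fin; lra.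
  apply: (integral_le_affine mOm fOm (G1 := fun=> 0) (G2 := fun=> 0)) => //;
    try by rewrite integral0.
  + apply: measurable_Psi; apply: measurable_funTS; apply: measurable_funB => //.
    exact: sm_measurable.
  + by rewrite mulr_ge0// ltW.
  + by move=> x; exact: Psi_ge0.
  + move=> x _; rewrite mul0r addr0.
    have h : `|u x - chi (r n) (f x)| <= 3 * d.
      rewrite (_ : _ - _ = (u x - Num.max (u x + - r n) 0) +
        (Num.max (u x + - r n) 0 - chi (r n) (u x + - r n)) +
        (chi (r n) (u x + - r n) - chi (r n) (f x))); last ring.
      rewrite (le_trans (ler_normD _ _))//.
      have h1 := le_trans (chi_lipschitz (r0 n) (u x + - r n) (f x)) (uf x).
      have h2 := chi_near (r0 n) (u x + - r n).
      have h3 : `|u x - Num.max (u x + - r n) 0| <= r n.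
        by have := u0 x; have := r0 n; rewrite ler_norml; have [?|?] := leP (u x + - r n) 0; lra.
      have h4 := ler_normD (u x - Num.max (u x + - r n) 0)
        (Num.max (u x + - r n) 0 - chi (r n) (u x + - r n)).
      by move: h1; rewrite le_min => /andP[h1 _]; lra.
    have d1 : `|3 * d| <= 1 by rewrite ger0_norm; lra.
    rewrite (le_trans (Psi_le q1 (t := 3 * d) _))//; first by rewrite [leRHS]ger0_norm//; lra.
    by apply: le_trans (Psi_lin q1 d1) _; rewrite powR1 ger0_norm; lra.
- move=> j; apply: (@le_trans _ _ (0 * V + psic q * (d + d))%:E); last by rewrite lee_fin; lra.
  have mGn : measurable_fun setT (G_ n j).
    by have [_ + _ _] := Sob_chi q1 mOm fOm (r0 n) (Sr n); apply.
  have mg : measurable_fun setT (partial j (fun x => chi (r n) (f x))).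
    by apply: sm_measurable; exact: sm_partial.
  apply: (integral_le_affine mOm fOm (G1 := fun x => Psi q (G j x - G_ n j x))
    (G2 := fun x => Psi q (G_ n j x - partial j (fun x => chi (r n) (f x)) x))) => //;
    try by move=> *; exact: Psi_ge0.
  + by apply: measurable_Psi; apply: measurable_funTS; exact: measurable_funB.
  + by apply: measurable_Psi; apply: measurable_funTS; exact: measurable_funB.
  + by apply: measurable_Psi; apply: measurable_funTS; exact: measurable_funB.
  + exact: ltW.
  + move=> x _; rewrite add0r (_ : G j x - _ = (G j x - G_ n j x) +
      (G_ n j x - partial j (fun x => chi (r n) (f x)) x)); last ring.
    exact: PsiD.
  + by apply: HN1; exact: leq_maxl.
  + apply: le_trans (Gf j) _; by rewrite lee_fin ge_min lexx.
Unshelve. all: by end_near. Qed.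
End sobolev_zero_trace.

(** * Vector fields *)

Section Lq_norms.
Context {R : realType} (q : R) (Om : set (R3 R)) (m : nat).
Hypothesis q1 : 1 < q.
Hypothesis mOm : measurable Om.
Hypothesis fOm : (leb3 Om < +oo)%E.
Implicit Type M : R3 R -> 'M[R]_(m, 3).
Let q0 : 0 < q. Proof. exact: lt_trans ltr01 q1. Qed.

Definition Lq_density M (x : R3 R) : R := \sum_(i < m) enorm (row i (M x)) `^ q.

Lemma Lq_density_ge0 M x : 0 <= Lq_density M x.
Proof. by apply: sumr_ge0 => i _; exact: powR_ge0. Qed.

Lemma enorm_row (n : nat) (A : 'M[R]_(n, 3)) i :
  enorm (row i A) = Num.sqrt (A i 0 ^+ 2 + A i 1 ^+ 2 + A i 2 ^+ 2).
Proof.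
rewrite /enorm big_ord1 !big_ord_recr big_ord0 /= add0r !mxE.
by congr (Num.sqrt (A i _ ^+ 2 + A i _ ^+ 2 + A i _ ^+ 2)); exact: val_inj.
Qed.

Lemma enorm_row_le (n : nat) (A : 'M[R]_(n, 3)) i :
  enorm (row i A) <= `|A i 0| + `|A i 1| + `|A i 2|.
Proof.
rewrite enorm_row; move: (A i 0) (A i 1) (A i 2) => a b c.
have s0 : 0 <= `|a| + `|b| + `|c| by rewrite !addr_ge0.
rewrite -[leRHS](ger0_norm s0) -[leRHS]sqrtr_sqr ler_sqrt ?sqr_ge0//.
rewrite -(real_normK (num_real a)) -(real_normK (num_real b)) -(real_normK (num_real c)).
have := normr_ge0 a; have := normr_ge0 b; have := normr_ge0 c.
by move: `|a| `|b| `|c| => x y z *; nra.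
Qed.

(** The square of [psic q] comes from applying [PsiD] twice to a sum of three entries. *)
Lemma Lq_density_le M x :
  Lq_density M x <= \sum_(i < m) psic q ^+ 2 *
    (Psi q (M x i 0) + Psi q (M x i 1) + Psi q (M x i 2)).
Proof.
apply: ler_sum => i _; set a := M x i 0; set b := M x i 1; set c := M x i 2.
have e0 : 0 <= enorm (row i (M x)) by exact: sqrtr_ge0.
apply: (@le_trans _ _ (Psi q (`|a| + `|b| + `|c|))).
  apply: (@le_trans _ _ (Psi q (enorm (row i (M x))))).
    by rewrite /Psi (ger0_norm e0) lerDr.
  apply: (Psi_le q1); rewrite (ger0_norm e0) ger0_norm ?addr_ge0//.
  exact: enorm_row_le.
have N t : Psi q `|t| = Psi q t by rewrite /Psi normr_id.
have c1 : 1 <= psic q by rewrite /psic; have := powR_ge0 2 q; lra.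
apply: le_trans (PsiD q1 _ _) _; rewrite N expr2 -mulrA ler_pM2l ?psic_gt0//.
rewrite mulrDr lerD//; first by rewrite -(N a) -(N b); exact: PsiD.
by rewrite ler_peMl// Psi_ge0.
Qed.

Lemma measurable_Lq_density M : measurable_field Om M -> measurable_fun Om (Lq_density M).
Proof.
move=> mM; apply: measurable_sum => i.
apply: (measurableT_comp (measurable_powR q)).
under eq_fun do rewrite enorm_row.
apply: (measurableT_comp (f := @Num.sqrt R)).
  by apply: continuous_measurable_fun; exact: sqrt_continuous.
by apply: measurable_funD; [apply: measurable_funD|];
  apply: (measurableT_comp (f := fun t : R => t ^+ 2)) => //; exact: exprn_measurable.
Qed.

Lemma Lq_norm_le M B : 0 <= B ->
  (\int[leb3]_(x in Om) (Lq_density M x)%:E <= B%:E)%E ->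
  (Lq_norm q Om M <= (B `^ q^-1)%:E)%E.
Proof.
move=> B0 iB; rewrite /Lq_norm -poweR_EFin; apply: gt0_ler_poweR => //.
- by rewrite invr_ge0 ltW.
- rewrite in_itv/= leey andbT; apply: integral_ge0 => x _.
  by rewrite lee_fin; exact: Lq_density_ge0.
- by rewrite in_itv/= leey andbT lee_fin.
Qed.

Lemma Lq_norm_small M e : 0 <= e -> measurable_field Om M ->
  (forall i j, (\int[leb3]_(x in Om) (Psi q (M x i j))%:E <= e%:E)%E) ->
  (Lq_norm q Om M <= ((m%:R * (psic q ^+ 2 * (3 * e))) `^ q^-1)%:E)%E.
Proof.
move=> e0 mM iM; have c0 := psic_gt0 q.
apply: Lq_norm_le; first by rewrite mulr_ge0// mulr_ge0 ?sqr_ge0// mulr_ge0.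
have mP i j : measurable_fun Om (fun x => (Psi q (M x i j))%:E).
  by apply/measurable_EFinP/measurable_Psi.
have P0 (t : R) : (0 <= (Psi q t)%:E)%E by rewrite lee_fin Psi_ge0.
have mS i : measurable_fun Om (fun x => (Psi q (M x i 0))%:E + (Psi q (M x i 1))%:E +
    (Psi q (M x i 2))%:E)%E.
  by apply: emeasurable_funD => //; exact: emeasurable_funD.
apply: (@le_trans _ _ (\int[leb3]_(x in Om) (\sum_(i < m) (psic q ^+ 2)%:E *
    ((Psi q (M x i 0))%:E + (Psi q (M x i 1))%:E + (Psi q (M x i 2))%:E)))%E).
  apply: ge0_le_integral => //.
  - by move=> x _; rewrite lee_fin Lq_density_ge0.
  - by apply/measurable_EFinP; exact: measurable_Lq_density.
  - by apply: emeasurable_sum => i; apply: measurable_funeM; exact: mS.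
  - by move=> x _; rewrite sumEFin lee_fin; exact: Lq_density_le.
rewrite ge0_integral_sum//; last 2 first.
- by move=> i; apply: measurable_funeM; exact: mS.
- by move=> i x _; apply: mule_ge0; [rewrite lee_fin sqr_ge0|apply: adde_ge0 => //; apply: adde_ge0].
apply: (@le_trans _ _ (\sum_(i < m) (psic q ^+ 2 * (3 * e))%:E)%E); last first.
  by rewrite sumEFin lee_fin sumr_const card_ord [leRHS]mulr_natl.
apply: lee_sum => i _; rewrite ge0_integralZl_EFin//; last 2 first.
- by move=> x _; rewrite !adde_ge0.
- exact: sqr_ge0.
rewrite [leRHS]EFinM lee_wpmul2l ?lee_fin ?sqr_ge0//.
rewrite ge0_integralD//; last 2 first.
- by move=> x _; rewrite adde_ge0.
- exact: emeasurable_funD.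
rewrite ge0_integralD// (_ : 3 * e = e + e + e); last ring.
by rewrite !EFinD !leeD.
Qed.

Lemma Lq_norm_lty M B : measurable_field Om M -> (forall x i j, `|M x i j| <= B) ->
  (Lq_norm q Om M < +oo)%E.
Proof.
move=> mM MB; pose e := Psi q B * fine (leb3 Om).
have e0 : 0 <= e by rewrite mulr_ge0 ?Psi_ge0// fine_ge0.
apply: le_lt_trans (Lq_norm_small e0 mM _) (ltry _) => i j.
apply: (@le_trans _ _ (\int[leb3]_(x in Om) (cst (Psi q B)%:E x))%E).
  apply: ge0_le_integral => //.
  - by move=> x _; rewrite lee_fin Psi_ge0.
  - by apply/measurable_EFinP/measurable_Psi.
  - move=> x _; rewrite lee_fin; apply: (Psi_le q1).
    by apply: le_trans (MB x i j) _; exact: ler_norm.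
by rewrite integral_cst// /e EFinM fineK// ge0_fin_numE.
Qed.
End Lq_norms.

Section vector_fields.
Context {R : realType} (q : R) (Om : set (R3 R)).
Hypothesis q1 : 1 < q.
Hypothesis mOm : measurable Om.
Hypothesis fOm : (leb3 Om < +oo)%E.
Let q0 : 0 < q. Proof. exact: lt_trans ltr01 q1. Qed.

(** [d] is chosen before [M], because the fields to which this is applied are built from
    approximants with error [d]. *)
Lemma Lq_norm_small_ex (m : nat) (eps : R) : 0 < eps -> exists2 d, 0 < d &
  forall M : R3 R -> 'M[R]_(m, 3), measurable_field Om M ->
  (forall i j, (\int[leb3]_(x in Om) (Psi q (M x i j))%:E <= d%:E)%E) ->
  (Lq_norm q Om M <= eps%:E)%E.
Proof.
move=> eps0; have A0 : 0 <= m%:R * (psic q ^+ 2 * 3).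
  by rewrite mulr_ge0// mulr_ge0// sqr_ge0.
have [d d0 dle] : exists2 d, 0 < d & m%:R * (psic q ^+ 2 * 3) * d <= eps `^ q.
  by apply: ex_small => //; exact: powR_gt0.
have dE : m%:R * (psic q ^+ 2 * (3 * d)) = m%:R * (psic q ^+ 2 * 3) * d by rewrite !mulrA.
have M0 : 0 <= m%:R * (psic q ^+ 2 * (3 * d)) by rewrite dE mulr_ge0// ltW.
exists d => // M mM iM; apply: le_trans (Lq_norm_small q1 mOm (ltW d0) mM iM) _.
have epsE : eps = (eps `^ q) `^ q^-1 by rewrite -powRrM mulfV ?gt_eqF// powRr1// ltW.
rewrite lee_fin [leRHS]epsE.
apply: ge0_ler_powR.
- by rewrite invr_ge0 ltW.
- by rewrite nnegrE.
- by rewrite nnegrE powR_ge0.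
- by rewrite dE.
Qed.

Lemma Sob_in_W1q0 (u : 'I_3 -> R3 R -> R) (G : 'I_3 -> 'I_3 -> R3 R -> R)
    (K : set (R3 R)) (B : R) :
  (forall i, Sob q Om (u i) (G i)) -> compact K -> K `<=` Om ->
  (forall i x, 0 < u i x -> K x) -> (forall i x, 0 <= u i x) -> (forall i x, u i x <= B) ->
  (forall i x, u i x <= 0 -> forall j, G i j x = 0) ->
  in_W1q0 q Om (fun x => \row_i u i x) (fun x => \matrix_(i, j) G i j x).
Proof.
move=> S cK KOm uK u0 uB G0.
have mu : measurable_field Om (fun x => \row_i u i x : 'rV[R]_3).
  by move=> i j; under eq_fun do rewrite mxE; apply: measurable_funTS; case: (S j).
have mG : measurable_field Om (fun x => \matrix_(i, j) G i j x : 'M[R]_3).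
  by move=> i j; under eq_fun do rewrite mxE; apply: measurable_funTS; case: (S i).
have [C GC] : exists C, forall i j x, `|G i j x| <= C.
  have H i : exists C, 0 <= C /\ forall j x, `|G i j x| <= C.
    by case: (S i) => _ _ [C C0 HC] _; exists C.
  have [c0 [c00 H0]] := H 0; have [c1 [c10 H1]] := H 1; have [c2 [c20 H2]] := H 2.
  exists (c0 + c1 + c2) => i j x; case: i => [[|[|[|//]]] il].
  - by rewrite (_ : Ordinal il = 0); [have := H0 j x; lra|exact: val_inj].
  - by rewrite (_ : Ordinal il = 1); [have := H1 j x; lra|exact: val_inj].
  - by rewrite (_ : Ordinal il = 2); [have := H2 j x; lra|exact: val_inj].
split; first split.
- split => //; apply: (Lq_norm_lty q1 mOm fOm mu (B := B)) => x i j.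
  by rewrite mxE ger0_norm.
- split => //; apply: (Lq_norm_lty q1 mOm fOm mG (B := C)) => x i j.
  by rewrite mxE.
- move=> phi tphi i j; under eq_integral do rewrite mxE.
  by under [in RHS]eq_integral do rewrite mxE; exact: Sob_weak.
- move=> eps eps0; have e3 : 0 < eps / 3 by rewrite divr_gt0.
  have [d1 d10 H1] := Lq_norm_small_ex 1 e3.
  have [d2 d20 H2] := Lq_norm_small_ex 3 e3.
  have d0 : 0 < Num.min d1 d2 by rewrite lt_min d10 d20.
  have /choice [f fP] : forall i, exists f, [/\ test_fun Om f, sm f,
    (\int[leb3]_(x in Om) (Psi q (u i x - f x))%:E <= (Num.min d1 d2)%:E)%E &
    forall j, (\int[leb3]_(x in Om) (Psi q (G i j x - partial j f x))%:E <= (Num.min d1 d2)%:E)%E].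
    by move=> i; apply: (Sob_zero_trace q1 mOm fOm (S i) cK KOm) => //; [exact: uK|exact: G0].
  have fE i : (fun x => (\row_k f k x : 'rV[R]_3) ord0 i) = f i by apply/funext => x; rewrite mxE.
  exists (fun x => \row_k f k x); split; first by move=> i; rewrite fE; case: (fP i).
  have uE x (i : 'I_1) (j : 'I_3) : ((\row_k u k x : 'rV[R]_3) - (\row_k f k x : 'rV[R]_3)) i j = u j x - f j x by rewrite !mxE.
  have GE x (i j : 'I_3) : ((\matrix_(k, l) G k l x : 'M[R]_3) - Defs.jacobian (fun y : R3 R => (\row_k f k y : 'rV[R]_3)) x) i j =
    G i j x - partial j (f i) x by rewrite !mxE fE.
  have smf i : sm (f i) by case: (fP i).
  apply: (@le_lt_trans _ _ (eps / 3 + eps / 3)%:E); last by rewrite lte_fin; lra.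
  rewrite EFinD leeD//.
  + apply: H1 => [i j|i j].
      under eq_fun do rewrite uE; apply: measurable_funTS; apply: measurable_funB; first by case: (S j).
      exact: sm_measurable.
    under eq_integral do rewrite uE; case: (fP j) => _ _ /le_trans + _; apply.
    by rewrite lee_fin ge_min lexx.
  + apply: H2 => [i j|i j].
      under eq_fun do rewrite GE; apply: measurable_funTS; apply: measurable_funB; first by case: (S i).
      by apply: sm_measurable; exact: sm_partial.
    under eq_integral do rewrite GE; case: (fP i) => _ _ _ /(_ j) /le_trans; apply.
    by rewrite lee_fin ge_min lexx orbT.
Qed.
End vector_fields.

(** * The folded function *)

Section folding.
Context {R : realType} (q : R) (Om : set (R3 R)).
Hypothesis q1 : 1 < q.
Hypothesis mOm : measurable Om.
Hypothesis fOm : (leb3 Om < +oo)%E.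
Variables (rho : R3 R -> R) (D : 'I_3 -> R3 R -> R).
Variables (v0 : R3 R -> R) (g0 : 'I_3 -> R3 R -> R).
Hypothesis Srho : Sob q Om rho D.
Hypothesis Sv0 : Sob q Om v0 g0.
Hypothesis rho_ge0 : forall x, 0 <= rho x.
Hypothesis D0 : forall x, rho x <= 0 -> forall j, D j x = 0.
Hypothesis v0_ge0 : forall x, 0 <= v0 x.
Hypothesis v0_le1 : forall x, v0 x <= 1.

Let h (k : nat) : R := 2^-1 ^+ k.
Let h_gt0 k : 0 < h k. Proof. by rewrite exprn_gt0// invr_gt0. Qed.
Let hS k : 2 * h k.+1 = h k.
Proof. by rewrite /h exprS mulrA mulfV ?mul1r// pnatr_eq0. Qed.

Fixpoint fold (k : nat) (x : R3 R) : R :=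
  if k is k'.+1 then
    Num.min (fold k' x) (Num.max (rho x) (h k') + -1 * fold k' x)
  else v0 x.

Fixpoint dfold (k : nat) (j : 'I_3) (x : R3 R) : R :=
  if k is k'.+1 then
    if Num.max (rho x) (h k') + -1 * fold k' x < fold k' x then
      (if h k' < rho x then D j x else 0) + -1 * dfold k' j x
    else dfold k' j x
  else g0 j x.

(** The recursions of [fold] and [dfold], including [-1 *] and the choice at ties, are those
    produced by [Sob_max], [Sob_scale], [Sob_add] and [Sob_min]. *)
Lemma Sob_fold k : Sob q Om (fold k) (dfold k).
Proof.
elim: k => [//|k IH].
have S1 := Sob_max q1 mOm fOm Srho (Sob_cst Om q1 (h k)).
have S2 := Sob_min q1 mOm fOm IH (Sob_add q1 mOm fOm S1 (Sob_scale mOm fOm (-1) IH)).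
exact: (Sob_eq S2).
Qed.

(** Put [m = max(rho, h k)]. Then [min(V, m - V) <= m / 2] gives the new upper bound, and the old
    one gives [V <= m], so the reflected value is nonnegative. The start uses [v0 <= 1 = h 0]. *)
Lemma fold_bounds k x : 0 <= fold k x /\ 2 * fold k x <= Num.max (rho x) (2 * h k).
Proof.
elim: k => [|k [IH0 IH]] /=.
  split; first exact: v0_ge0.
  by rewrite le_max; apply/orP; right; have := v0_le1 x; rewrite /h expr0; lra.
rewrite hS; have hk := h_gt0 k; split.
  rewrite le_min IH0 /=; move: IH; have [?|?] := leP (rho x) (2 * h k);
    have [?|?] := leP (rho x) (h k); lra.
by have [?|?] := leP (fold k x) (Num.max (rho x) (h k) + -1 * fold k x); lra.
Qed.

Lemma fold_frozen k x : 2 * h k <= rho x ->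
  forall n, (k <= n)%N -> fold n x = fold k x /\ forall j, dfold n j x = dfold k j x.
Proof.
move=> hk; elim=> [|n IH]; first by rewrite leqn0 => /eqP ->.
rewrite leq_eqVlt => /predU1P[<- //|]; rewrite ltnS => kn.
have [<- dE] := IH kn.
have hn : 2 * h n <= rho x.
  apply: le_trans hk; rewrite ler_pM2l// /h ler_wiXn2l// ?invr_ge0//.
  by rewrite invf_le1// ler1n.
have [_] := fold_bounds n x; rewrite (max_idPl hn) => fn.
have hr : h n <= rho x by have := h_gt0 n; lra.
have nlt : (rho x + -1 * fold n x < fold n x) = false by apply/negbTE; rewrite -leNgt; lra.
split; first by rewrite /= (max_idPl hr); apply/min_idPl; lra.
by move=> j; rewrite /= (max_idPl hr) nlt dE.
Qed.

(* [t = 1] can only occur once [2 h_k <= rho], and from then on [fold] no longer changes. *)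
Lemma dfoldE k x : exists s t : R, [/\ s = 1 \/ s = -1,
  t = 0 \/ (t = 1 /\ 2 * h k <= rho x) & forall j, dfold k j x = s * g0 j x + t * D j x].
Proof.
elim: k => [|k [s [t [s1 tP dE]]]].
  by exists 1, 0; split; [left|left|move=> j; rewrite mul1r mul0r addr0].
have [hk|hk] := leP (2 * h k) (rho x).
  exists s, t; split => // [|j]; last by have [_ ->] := fold_frozen hk (leqnSn k); rewrite dE.
  case: tP => [|[t1 _]]; [by left|right; split => //].
  by rewrite hS; have := h_gt0 k; lra.
have t0 : t = 0 by case: tP => // -[_]; rewrite leNgt hk.
have Ns : - s = 1 \/ - s = -1 by case: s1 => ->; rewrite ?opprK; [right|left].
have E j : dfold k.+1 j x =
  if Num.max (rho x) (h k) + -1 * fold k x < fold k x then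
    (if h k < rho x then D j x else 0) + -1 * dfold k j x
  else dfold k j x by [].
case: (_ < fold k x) E => E; last first.
  by exists s, t; split => // [|j]; [left|rewrite E].
have [hr|hr] := ltP (h k) (rho x).
  exists (- s), 1; split => // [|j]; last by rewrite E hr dE t0; ring.
  by right; rewrite hS ltW.
exists (- s), 0; split => // [|j]; first by left.
by rewrite E ltNge hr /= dE t0; ring.
Qed.

Lemma folding_exists : exists W dW, [/\ Sob q Om W dW,
  forall x, 0 <= W x <= rho x,
  forall x, rho x <= 0 -> forall j, dW j x = 0 &
  forall x, 0 < rho x -> exists s t : R, [/\ s = 1 \/ s = -1, t = 0 \/ t = 1 &
    forall j, dW j x = s * g0 j x + t * D j x]].
Proof.
have hcvg : h @ \oo --> (0 : R).
  by apply: cvg_expr; rewrite ger0_norm ?invr_ge0// invf_lt1// ltr1n.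
have /cvgrPdist_le hP := hcvg.
have /choice[K KP] : forall x, exists k, 0 < rho x -> 2 * h k <= rho x.
  move=> x; have [r0|r0] := ltP 0 (rho x); last by exists 0%N.
  have r20 : 0 < rho x / 2 by rewrite divr_gt0.
  have [N _ HN] := hP _ r20; exists N => _.
  by have := HN N (leqnn N); rewrite sub0r normrN ger0_norm ?(ltW (h_gt0 _))//; lra.
(* At a point with [rho x > 0] the folds are constant from stage [K x] on, so the limit and its
   gradient are read off there. *)
pose W x := if 0 < rho x then fold (K x) x else 0.
pose dW j x := if 0 < rho x then dfold (K x) j x else 0.
have Wb x : 0 <= W x <= rho x.
  rewrite /W; case: ifPn => r0; last by rewrite lexx rho_ge0.
  by have [-> ] := fold_bounds (K x) x; rewrite (max_idPl (KP x r0)) /=; lra.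
exists W, dW; split; [|exact: Wb| |]; last 2 first.
- by move=> x r0 j; rewrite /dW ltNge r0.
- move=> x r0; have [s [t [s1 tP dE]]] := dfoldE (K x) x.
  exists s, t; split => //; last by move=> j; rewrite /dW r0.
  by case: tP => [|[]]; [left|right].
have [_ _ [B B0 DB] _] := Srho; have [_ _ [C C0 gC] _] := Sv0.
(* Where [rho = 0] the gradients [dfold k] need not converge. Taking the minimum with [rho] replaces
   them there by [D = 0] and changes nothing once the folds are frozen. *)
apply: (Sob_limit q1 mOm fOm
  (u_ := fun k x => Num.min (rho x) (fold k x))
  (G_ := fun k j x => if fold k x < rho x then dfold k j x else D j x) (B := B + C)).
- by move=> k; exact: (Sob_min q1 mOm fOm Srho (Sob_fold k)).
- move=> k j x; case: ifPn => _; last by rewrite (le_trans (DB j x))// lerDl.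
  have [s [t [s1 tP ->]]] := dfoldE k x.
  have hs : `|s| = 1 by case: s1 => ->; rewrite ?normrN normr1.
  have ht : `|t| <= 1 by case: tP => [->|[-> _]]; rewrite ?normr0 ?normr1.
  rewrite (le_trans (ler_normD _ _))// !normrM hs mul1r addrC lerD//.
  by rewrite -[leRHS]mul1r ler_pM.
- move=> e e0; have e20 : 0 < e / 2 by rewrite divr_gt0.
  have [N _ HN] := hP _ e20; exists N => n x Nn.
  have [f0 f1] := fold_bounds n x.
  have he : 2 * h n <= e.
    by have := HN n Nn; rewrite sub0r normrN ger0_norm ?(ltW (h_gt0 _))//; lra.
  (* Either stage [n] is already frozen, or [rho x < 2 * h n <= e] and both functions lie between 0
     and [rho x]. *)
  have [hn|hn] := leP (2 * h n) (rho x).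
    have r0 : 0 < rho x by have := h_gt0 n; lra.
    have -> : W x = fold n x.
      rewrite /W r0; case: (leqP n (K x)) => nK; first by have [] := fold_frozen hn nK.
      by have [->] := fold_frozen (KP x r0) (ltnW nK).
    have -> : Num.min (rho x) (fold n x) = fold n x.
      by apply/min_idPr; move: f1; rewrite (max_idPl hn); lra.
    by rewrite subrr normr0 ltW.
  have /andP[W0 W1] := Wb x.
  have m0 : 0 <= Num.min (rho x) (fold n x) by rewrite le_min rho_ge0.
  have m1 : Num.min (rho x) (fold n x) <= rho x by rewrite ge_min lexx.
  by rewrite ler_norml; lra.
- move=> j x; have [r0|r0] := ltP 0 (rho x); last first.
    rewrite /dW ltNge r0 /= D0//; under eq_fun => k.
      by rewrite ltNge (le_trans r0 (fold_bounds k x).1) /=; over.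
    exact: cvg_cst.
  rewrite /dW r0; apply: cvg_near_cst; exists (K x) => // n /= Kn.
  have [-> ->] := fold_frozen (KP x r0) Kn.
  rewrite ifT//; have [_] := fold_bounds (K x) x.
  by rewrite (max_idPl (KP x r0)); lra.
Qed.
End folding.

(** * Shells *)

Definition unit_dir {R : realType} (g : 'I_3 -> R) : Prop :=
  exists i s, (s = 1 \/ s = -1) /\ forall j, g j = s * (i == j)%:R.

Lemma unit_dir_if {R : realType} (b : bool) (g h : 'I_3 -> R) :
  unit_dir g -> unit_dir h -> unit_dir (fun j => if b then g j else h j).
Proof. by case: b. Qed.

Section shell.
Context {R : realType} (q : R) (Om : set (R3 R)).
Hypothesis q1 : 1 < q.
Hypothesis mOm : measurable Om.
Hypothesis fOm : (leb3 Om < +oo)%E.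
Variables (c : R3 R).

Definition cube_dist (x : R3 R) : R :=
  Num.max (Num.max `|crd 0 x - crd 0 c| `|crd 1 x - crd 1 c|) `|crd 2 x - crd 2 c|.

Lemma Sob_cube_dist : exists2 D, Sob q Om cube_dist D & forall x, unit_dir (fun j => D j x).
Proof.
have H i : exists2 D, Sob q Om (fun x => `|crd i x - crd i c|) D &
    forall x, unit_dir (fun j => D j x).
  have S1 := Sob_add q1 mOm fOm (Sob_crd Om q1 i) (Sob_cst Om q1 (- crd i c)).
  have S2 := Sob_max q1 mOm fOm S1 (Sob_scale mOm fOm (-1) S1).
  have absE (y : R) : `|y| = Num.max y (-1 * y).
    have [y0|y0] := leP 0 y; [rewrite ger0_norm//|rewrite ltr0_norm//]; apply/esym.
      by apply/max_idPl; lra.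
    by rewrite mulN1r; apply/max_idPr; lra.
  eexists; first by apply: (Sob_eq S2) => // x; exact: absE.
  move=> x /=; apply: unit_dir_if; [exists i, 1|exists i, (-1)]; split; try by [left|right].
    by move=> j; rewrite addr0 mul1r.
  by move=> j; rewrite addr0.
have [D0 S0 H0] := H 0; have [D1 S1 H1] := H 1; have [D2 S2 H2] := H 2.
eexists; first exact: (Sob_max q1 mOm fOm (Sob_max q1 mOm fOm S0 S1) S2).
by move=> x /=; do 2! apply: unit_dir_if => //.
Qed.

Definition shell_fun (a b : R) (x : R3 R) : R :=
  Num.max (Num.min (cube_dist x - a) (b - cube_dist x)) 0.

Lemma Sob_shell_fun a b : exists D, [/\ Sob q Om (shell_fun a b) D,
  forall x, shell_fun a b x <= 0 -> forall j, D j x = 0 &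
  forall x, 0 < shell_fun a b x -> unit_dir (fun j => D j x)].
Proof.
have [D SD HD] := Sob_cube_dist.
have S1 := Sob_add q1 mOm fOm SD (Sob_cst Om q1 (- a)).
have S2 := Sob_add q1 mOm fOm (Sob_cst Om q1 b) (Sob_scale mOm fOm (-1) SD).
have S3 := Sob_pos q1 mOm fOm (Sob_min q1 mOm fOm S1 S2).
have minE x : Num.min (cube_dist x + - a) (b + -1 * cube_dist x) =
    Num.min (cube_dist x - a) (b - cube_dist x) by rewrite mulN1r.
eexists; split.
- by apply: (Sob_eq S3) => // x; rewrite minE.
- move=> x; rewrite /shell_fun -minE /=; set m := Num.min _ _ => m0 j.
  by rewrite ltNge (le_trans _ m0)// le_max lexx.
- move=> x; rewrite /shell_fun -minE /=; set m := Num.min _ _ => m0.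
  have -> : 0 < m by move: m0; rewrite lt_max ltxx orbF.
  have [i [s [s1 DE]]] := HD x; apply: unit_dir_if.
    exists i, (- s); split; first by case: s1 => ->; rewrite ?opprK; [right|left].
    by move=> j; rewrite DE; ring.
  by exists i, s; split => // j; rewrite DE addr0.
Qed.

Lemma shell_fun_ge0 a b x : 0 <= shell_fun a b x.
Proof. by rewrite le_max lexx orbT. Qed.

Lemma shell_fun_gt0 a b x : (0 < shell_fun a b x) = (a < cube_dist x < b).
Proof. by rewrite /shell_fun lt_max ltxx orbF lt_min !subr_gt0. Qed.

Lemma shell_fun_le a b x : a <= b -> shell_fun a b x <= b - a.
Proof.
move=> ab; rewrite /shell_fun ge_max subr_ge0 ab andbT.
by have [?|?] := leP (cube_dist x - a) (b - cube_dist x); lra.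
Qed.

Definition closed_cube (r : R) : set (R3 R) :=
  ((`[c.1.1 - r, c.1.1 + r]%classic `*` `[c.1.2 - r, c.1.2 + r]%classic)
   `*` `[c.2 - r, c.2 + r]%classic).

Lemma closed_cubeP r x : cube_dist x <= r -> closed_cube r x.
Proof.
rewrite /cube_dist !ge_max /crd /= => /andP[/andP[h0 h1] h2].
by split; [split|]; rewrite /= in_itv/=; move: h0 h1 h2;
  rewrite !ler_norml => /andP[? ?] /andP[? ?] /andP[? ?]; apply/andP; split; lra.
Qed.

Lemma closed_cube_compact r : compact (closed_cube r).
Proof. by apply: compact_setX; [apply: compact_setX|]; exact: segment_compact. Qed.

Lemma closed_cube_ball r r' : r < r' -> closed_cube r `<=` ball c r'.
Proof.
move=> rr' x [[]] /=; rewrite !in_itv/= => /andP[? ?] /andP[? ?] /andP[? ?].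
by split; [split|]; rewrite /ball/= ltr_norml; apply/andP; split; lra.
Qed.

(** The shell contains a box over one face of the inner cube: the first coordinate exceeds that of
    the centre by between [a] and [b], the other two differ by less than [a]. *)
Lemma leb3_shell_ge a b : 0 < a -> a < b ->
  (((b - a) * (2 * a) ^+ 2)%:E <= leb3 [set x | (0 < shell_fun a b x)%R])%E.
Proof.
move=> a0 ab.
pose I1 : set (measurableTypeR R) := `]c.1.1 + a, c.1.1 + b[%classic.
pose I2 : set (measurableTypeR R) := `]c.1.2 - a, c.1.2 + a[%classic.
pose I3 : set (measurableTypeR R) := `]c.2 - a, c.2 + a[%classic.
have m1 : measurable I1 by exact: measurable_itv.
have m2 : measurable I2 by exact: measurable_itv.
have m3 : measurable I3 by exact: measurable_itv.
have sub : (I1 `*` I2) `*` I3 `<=` [set x | 0 < shell_fun a b x].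
  move=> x [[]] /=; rewrite /I1 /I2 /I3 /= !in_itv/= => /andP[h1 h2] /andP[h3 h4] /andP[h5 h6].
  rewrite shell_fun_gt0 /cube_dist /crd /= !lt_max !gt_max !ltr_norml.
  have -> : a < `|x.1.1 - c.1.1| by rewrite (lt_le_trans _ (ler_norm _))//; lra.
  by rewrite /=; apply/andP; split; [apply/andP; split|]; apply/andP; split; lra.
have mS : measurable [set x | 0 < shell_fun a b x].
  have [D [[mu _ _ _] _ _]] := Sob_shell_fun a b.
  rewrite (_ : [set x | _] = setT `&` (shell_fun a b @^-1` `]0, +oo[%classic)).
    by apply: mu => //; exact: measurable_itv.
  by apply/seteqP; split => [x /= r0|x [_]] /=; rewrite in_itv/= andbT.
apply: (@le_trans _ _ (leb3 ((I1 `*` I2) `*` I3))); last first.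
  by apply: le_measure; rewrite ?inE//; do 2 apply: measurableX => //.
rewrite leb3_box// !lebesgue_measure_itv/= !lte_fin.
rewrite !ifT; [|lra..].
by rewrite -!EFinB -!EFinM lee_fin le_eqVlt; apply/orP; left; apply/eqP; ring.
Qed.
End shell.

(** * Linear algebra in dimension three *)

Section algebra.
Context {R : realType}.
Variables (g h : 'I_3 -> R).

(** The cross product; addition in ['I_3] is modulo 3, which makes the indices cyclic. *)
Definition vprod (a b : 'I_3 -> R) (i : 'I_3) : R :=
  a (i + 1) * b (i + 2) - a (i + 2) * b (i + 1).

Let n := vprod g h.
Let N := n 0 ^+ 2 + n 1 ^+ 2 + n 2 ^+ 2.

(* The inverse of the matrix with rows -h, g and n / |n|^2, where n = g x h. *)
Definition Pmat : 'M[R]_3 := \matrix_(i, j)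
  (if j == 0 then vprod g n i / N else if j == 1 then vprod h n i / N else n i).

Definition grad_mat : 'M[R]_3 := \matrix_(i, j)
  (if i == 0 then g j else if i == 1 then h j else 0).

Let o01 : 0 + 1 = 1 :> 'I_3. Proof. exact: val_inj. Qed.
Let o02 : 0 + 2 = 2 :> 'I_3. Proof. exact: val_inj. Qed.
Let o11 : 1 + 1 = 2 :> 'I_3. Proof. exact: val_inj. Qed.
Let o12 : 1 + 2 = 0 :> 'I_3. Proof. exact: val_inj. Qed.
Let o21 : 2 + 1 = 0 :> 'I_3. Proof. exact: val_inj. Qed.
Let o22 : 2 + 2 = 1 :> 'I_3. Proof. exact: val_inj. Qed.
Let oE := (o01, o02, o11, o12, o21, o22).

Lemma sum3 (F : 'I_3 -> R) : \sum_i F i = F 0 + F 1 + F 2.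
Proof.
rewrite !big_ord_recr big_ord0 /= add0r.
by congr (F _ + F _ + F _); exact: val_inj.
Qed.

Lemma det3 (A : 'M[R]_3) : \det A =
  A 0 0 * (A 1 1 * A 2 2 - A 1 2 * A 2 1) - A 0 1 * (A 1 0 * A 2 2 - A 1 2 * A 2 0)
  + A 0 2 * (A 1 0 * A 2 1 - A 1 1 * A 2 0).
Proof.
pose a (i j : nat) := A (inord i) (inord j).
have AE (i j : 'I_3) : A i j = a i j by rewrite /a !inord_val.
rewrite (expand_det_row _ 0) sum3 /cofactor !(expand_det_row _ ord0) !big_ord_recr !big_ord0 /=.
rewrite /cofactor !det_mx11 !mxE !AE /= /bump /=.
by rewrite !(expr0, expr1, mul1r, mulN1r, exprS, add0r); ring.
Qed.

Lemma det_Pmat : N != 0 -> \det Pmat = 1.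
Proof.
move=> N0; rewrite det3 !mxE /= /vprod !oE.
move: N0; rewrite /N /n /vprod !oE => N0; field.
exact: N0.
Qed.

(** The product has 1 at (0,1), -1 at (1,0) and zeros elsewhere: [g] and [h] are orthogonal to [n],
    and [g . (h x n) = (g x h) . n = N = - h . (g x n)]. *)
Lemma grad_mat_Pmat_skew : N != 0 ->
  grad_mat *m Pmat + (grad_mat *m Pmat)^T = 0.
Proof.
move=> N0; apply/matrixP => i j; rewrite !mxE !sum3 !mxE.
rewrite /vprod !oE; move: N0; rewrite /N /n /vprod !oE => N0.
by case: i => [[|[|[|//]]] ?]; case: j => [[|[|[|//]]] ?]; rewrite /=; field;
  first [exact: N0|exact: isT].
Qed.
End algebra.

(** * Assembly *)

(** For the field [P], which follows a different formula on each of countably many shells. *)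
Lemma measurable_select {R : realType} d (T : measurableType d) (E : nat -> set T)
    (f_ : nat -> T -> R) (f : T -> R) (c : R) :
  (forall n, measurable (E n)) -> (forall n, measurable_fun setT (f_ n)) ->
  (forall n x, E n x -> f x = f_ n x) -> (forall x, (forall n, ~ E n x) -> f x = c) ->
  measurable_fun setT f.
Proof.
move=> mE mf_ fE fc _ Y mY; rewrite setTI.
have -> : f @^-1` Y = \bigcup_n (E n `&` (f_ n @^-1` Y)) `|`
    ((\bigcap_n ~` E n) `&` (if c \in Y then setT else set0)).
  apply/seteqP; split => x /=.
    move=> Yx; have [[n Enx]|nE] := pselect (exists n, E n x).
      by left; exists n => //; split => //=; rewrite -fE.
    have nEx n : ~ E n x by move=> Ex; apply: nE; exists n.
    right; split => [n _|]; first exact: nEx.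
    by rewrite -(fc x)// ifT// inE.
  case=> [[n _ [Ex]]|[nE]] /=; first by rewrite -fE.
  case: ifPn => // /set_mem Yc _; rewrite /preimage/= fc// => n; exact: nE.
apply: measurableU.
  apply: bigcupT_measurable => n; apply: measurableI => //.
  by rewrite -[X in measurable X]setTI; exact: mf_.
apply: measurableI; last by case: ifP.
by apply: bigcapT_measurable => n; exact: measurableC.
Qed.

Lemma enorm_le {R : realType} (m n : nat) (A : 'M[R]_(m, n)) (C : R) :
  (forall i j, `|A i j| <= C) -> enorm A <= Num.sqrt (\sum_(i < m) \sum_(j < n) C ^+ 2).
Proof.
move=> AC; apply: ler_wsqrtr; apply: ler_sum => i _; apply: ler_sum => j _.
rewrite -(real_normK (num_real (A i j))) ler_sqr ?nnegrE//.
exact: le_trans (AC i j).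
Qed.

(** The lower bound needs a nonzero measure: for the zero measure the essential supremum is
    [-oo]. *)
Lemma Linfty_norm_bounds {R : realType} (m n : nat) (Om : set (R3 R))
    (M : R3 R -> 'M[R]_(m, n)) (B : R) : (0 < leb3 Om)%E -> measurable Om -> 0 <= B ->
  (forall x, Om x -> enorm (M x) <= B) ->
  (0 <= Linfty_norm Om M)%E /\ (Linfty_norm Om M <= B%:E)%E.
Proof.
move=> Om0 mOm B0 MB; split.
  apply: ess_sup_gee.
    by apply: lt_le_trans Om0 _; apply: le_measure; rewrite ?inE//; exact: measurableT.
  by apply: nearW => x; case: ifP => _ //; rewrite lee_fin sqrtr_ge0.
apply/ess_supP; apply: nearW => x; case: ifP => [/set_mem Ox|_]; rewrite lee_fin//.
exact: MB.
Qed.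

Lemma enorm_rowZ {R : realType} (c : R) (m : nat) (A : 'M[R]_(m, 3)) i : 0 <= c ->
  enorm (row i (c *: A)) = c * enorm (row i A).
Proof.
move=> c0; rewrite !enorm_row !mxE !exprMn -!mulrDr sqrtrM ?sqr_ge0//.
by rewrite sqrtr_sqr ger0_norm.
Qed.

(** Multiples of [g] drop out, leaving [s * k] times [g x (1,1,1)]; for [g = +-e_i] this vector has
    one entry 0 and two entries of absolute value 1. *)
Lemma vprod_unit_dir {R : realType} (g h : 'I_3 -> R) (k s t : R) :
  unit_dir g -> s = 1 \/ s = -1 -> (forall j, h j = g j + (s * k + t * g j)) ->
  vprod g h 0 ^+ 2 + vprod g h 1 ^+ 2 + vprod g h 2 ^+ 2 = 2 * k ^+ 2.
Proof.
move=> [i [s' [s'1 gE]]] s1 hE; rewrite /vprod !hE !gE.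
case: i gE => [[|[|[|//]]] il] gE; rewrite /= -?val_eqE /=;
  by case: s'1 => ->; case: s1 => ->; ring.
Qed.

(** Folding wants values in [0, 1] on the whole space, while the gradient matters only on [Om]. With
    [k = 1 / (8 M)] the linear function stays in [1/8, 7/8] on [Om], so the clipping acts outside
    only. *)
Lemma Sob_clip {R : realType} (q : R) (Om : set (R3 R)) (M : R) :
  1 < q -> measurable Om -> (leb3 Om < +oo)%E -> 0 < M -> (forall x i, Om x -> `|crd i x| <= M) ->
  exists v0 g0 k, [/\ Sob q Om v0 g0, forall x, 0 <= v0 x, forall x, v0 x <= 1, 0 < k &
    forall x j, Om x -> g0 j x = k].
Proof.
move=> q1 mOm fOm M0 OmM; pose k := (8 * M)^-1.
have k0 : 0 < k by rewrite invr_gt0 mulr_gt0.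
have kM : k * M = 8^-1 by rewrite /k; field; rewrite gt_eqF.
have S0 := Sob_add q1 mOm fOm (Sob_add q1 mOm fOm (Sob_crd Om q1 0) (Sob_crd Om q1 1))
  (Sob_crd Om q1 2).
have S1 := Sob_add q1 mOm fOm (Sob_scale mOm fOm k S0) (Sob_cst Om q1 2^-1).
have S2 := Sob_max q1 mOm fOm (Sob_min q1 mOm fOm S1 (Sob_cst Om q1 1)) (Sob_cst Om q1 0).
do 2 eexists; exists k; split; [exact: S2| | |by []|] => [x|x|x j Ox] /=.
- by rewrite le_max lexx orbT.
- by rewrite ge_max ler01 ge_min lexx orbT.
have kb i : `|k * crd i x| <= 8^-1.
  by rewrite normrM gtr0_norm// -kM ler_pM2l// OmM.
have := kb 0; have := kb 1; have := kb 2; rewrite !ler_norml => /andP[? ?] /andP[? ?] /andP[? ?].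
have L1 : (1 < k * (crd 0 x + crd 1 x + crd 2 x) + 2^-1) = false.
  by apply/negbTE; rewrite -leNgt; lra.
rewrite L1 ifT; last by rewrite lt_min ltr01 andbT; lra.
by case: j => [[|[|[|//]]] jl]; rewrite -?val_eqE /=; ring.
Qed.

(** One predicate on a triple, so that [choice] yields the whole sequence. Here [w] stands for
    [rho + W]; the two-sided bound makes it positive exactly where [rho] is. *)
Definition shell_data {R : realType} (q : R) (Om : set (R3 R)) (p : R3 R) (k a b : R)
    (t : ('I_3 -> R3 R -> R) * (R3 R -> R) * ('I_3 -> R3 R -> R)) : Prop :=
  let: (g, w, h) := t in let rho := shell_fun p a b in
  [/\ Sob q Om rho g, Sob q Om w h,
      forall x, rho x <= w x <= 2 * rho x,
      forall x, rho x <= 0 -> forall j, g j x = 0 /\ h j x = 0 &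
      forall x, Om x -> 0 < rho x -> unit_dir (g ^~ x) /\ exists s t : R,
        [/\ s = 1 \/ s = -1, t = 0 \/ t = 1 & forall j, h j x = g j x + (s * k + t * g j x)]].

Lemma shell_data_exists {R : realType} (q : R) (Om : set (R3 R)) (p : R3 R) (k a b : R) v0 g0 :
  1 < q -> measurable Om -> (leb3 Om < +oo)%E ->
  Sob q Om v0 g0 -> (forall x, 0 <= v0 x) -> (forall x, v0 x <= 1) ->
  (forall x j, Om x -> g0 j x = k) -> exists t, shell_data q Om p k a b t.
Proof.
move=> q1 mOm fOm Sv v00 v01 g0k.
have [D [SD D0 Du]] := Sob_shell_fun q1 mOm fOm p a b.
have [W [dW [SW Wb dW0 dWP]]] :=
  folding_exists q1 mOm fOm SD Sv (shell_fun_ge0 p a b) D0 v00 v01.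
exists (D, (fun x => shell_fun p a b x + W x), (fun j x => D j x + dW j x)); split.
- exact: SD.
- exact: Sob_add.
- by move=> x; have /andP[? ?] := Wb x; apply/andP; split; lra.
- by move=> x r0 j; rewrite D0// dW0// addr0.
- move=> x Ox r0; split; first exact: Du.
  have [s [t [s1 tP dE]]] := dWP x r0.
  by exists s, t; split => // j; rewrite dE g0k.
Qed.

Section assembly.
Context {R : realType} (q : R) (Om : set (R3 R)).
Hypothesis q1 : 1 < q.
Hypothesis mOm : measurable Om.
Hypothesis fOm : (leb3 Om < +oo)%E.
Variables (p : R3 R) (k r : R).
Hypothesis k0 : 0 < k.
Hypothesis r0 : 0 < r.
Hypothesis cubeOm : closed_cube p (2 * r) `<=` Om.

Let half (n : nat) : R := 2^-1 ^+ n.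
Let half_gt0 n : 0 < half n. Proof. by rewrite exprn_gt0// invr_gt0. Qed.
Let halfS n : half n = 2 * half n.+1.
Proof. by rewrite /half exprS mulrA mulfV ?mul1r// pnatr_eq0. Qed.
Let half_le1 n : half n <= 1.
Proof. by rewrite exprn_ile1 ?invr_ge0// invf_le1// ler1n. Qed.
Let half_le n m : (n <= m)%N -> half m <= half n.
Proof. by move=> nm; rewrite ler_wiXn2l ?invr_ge0// invf_le1// ler1n. Qed.

(** Consecutive shells abut, [a n = b n.+1], and are disjoint because they are open; all lie in the
    cube of radius [2 * r], outside the one of radius [r]. *)
Let a n : R := r * (1 + half n.+1).
Let b n : R := r * (1 + half n).
Let rho n := shell_fun p (a n) (b n).
Variable F : nat -> ('I_3 -> R3 R -> R) * (R3 R -> R) * ('I_3 -> R3 R -> R).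
Hypothesis FP : forall n, shell_data q Om p k (a n) (b n) (F n).
Let g n := (F n).1.1.
Let w n := (F n).1.2.
Let h n := (F n).2.

Let FP' n : [/\ Sob q Om (rho n) (g n), Sob q Om (w n) (h n),
      forall x, rho n x <= w n x <= 2 * rho n x,
      forall x, rho n x <= 0 -> forall j, g n j x = 0 /\ h n j x = 0 &
      forall x, Om x -> 0 < rho n x -> unit_dir ((g n) ^~ x) /\ exists s t : R,
        [/\ s = 1 \/ s = -1, t = 0 \/ t = 1 & forall j, h n j x = g n j x + (s * k + t * g n j x)]].
Proof. by have := FP n; rewrite /g /w /h; case: (F n) => [[]]. Qed.

Let baE n : b n - a n = r * half n.+1.
Proof. by rewrite /b /a halfS; ring. Qed.

Let ab n : a n < b n.
Proof. by rewrite -subr_gt0 baE mulr_gt0. Qed.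

Let a_ge n : r <= a n.
Proof. by rewrite /a mulrDr mulr1 lerDl mulr_ge0// ltW. Qed.

Let b_le n : b n <= 2 * r.
Proof. by rewrite /b mulrC ler_pM2r//; have := half_le1 n; lra. Qed.

Let rho_cube n x : 0 < rho n x -> closed_cube p (2 * r) x.
Proof.
rewrite shell_fun_gt0 => /andP[_ xb]; apply: closed_cubeP.
exact: le_trans (ltW xb) (b_le n).
Qed.

Let rho_Om n x : 0 < rho n x -> Om x.
Proof. by move=> /rho_cube /cubeOm. Qed.

Let rho_disj n m x : 0 < rho n x -> 0 < rho m x -> n = m.
Proof.
wlog nm : n m / (n < m)%N.
  by move=> H n0 m0; case: (ltngtP n m) => // nm; [exact: H|apply/esym; exact: H].
rewrite !shell_fun_gt0 => /andP[an _] /andP[_ bm].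
have : b m <= a n by rewrite /b /a ler_pM2l// lerD2l half_le.
by move=> ba; have := lt_trans an bm; rewrite ltNge ba.
Qed.

Let mrho n : measurable [set x | 0 < rho n x].
Proof.
have [[mr _ _ _] _ _ _ _] := FP' n.
rewrite (_ : [set x | _] = setT `&` (rho n @^-1` `]0, +oo[%classic)).
  by apply: mr => //; exact: measurable_itv.
by apply/seteqP; split => [x /= x0|x [_]] /=; rewrite in_itv/= andbT.
Qed.

Let mg n j : measurable_fun setT (g n j).
Proof. by have [[_ + _ _] _ _ _ _] := FP' n; apply. Qed.

Let mh n j : measurable_fun setT (h n j).
Proof. by have [_ [_ + _ _] _ _ _] := FP' n; apply. Qed.

Let g_le1 n x j : 0 < rho n x -> `|g n j x| <= 1.
Proof.
move=> x0; have [_ _ _ _ /(_ x (rho_Om x0) x0)[[i [s [s1 ->]]] _]] := FP' n.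
by case: s1 => ->; case: (i == j); rewrite ?mulr1 ?mulr0 ?normrN ?normr1 ?normr0.
Qed.

Let h_le n x j : 0 < rho n x -> `|h n j x| <= 2 + k.
Proof.
move=> x0; have gl := g_le1 j x0; move: gl.
have [_ _ _ _ /(_ x (rho_Om x0) x0)[_ [s [t [s1 t1 ->]]]]] := FP' n.
move: (g n j x) k0 => y; rewrite !ler_norml => kp /andP[? ?]; apply/andP.
by case: s1 => ->; case: t1 => ->; split; lra.
Qed.

Let vprod_le n x i : 0 < rho n x -> `|vprod ((g n) ^~ x) ((h n) ^~ x) i| <= 2 * (2 + k).
Proof.
move=> x0; rewrite /vprod (le_trans (ler_normB _ _))// !normrM.
have H (i' j' : 'I_3) : `|g n i' x| * `|h n j' x| <= 1 * (2 + k).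
  by rewrite ler_pM// ?g_le1// h_le.
by have := H (i + 1) (i + 2); have := H (i + 2) (i + 1); lra.
Qed.

Let normsq n x : 0 < rho n x ->
  vprod ((g n) ^~ x) ((h n) ^~ x) 0 ^+ 2 + vprod ((g n) ^~ x) ((h n) ^~ x) 1 ^+ 2 + vprod ((g n) ^~ x) ((h n) ^~ x) 2 ^+ 2 =
  2 * k ^+ 2.
Proof.
move=> x0; have [_ _ _ _ /(_ x (rho_Om x0) x0)[ug [s [t [s1 _ hE]]]]] := FP' n.
exact: vprod_unit_dir ug s1 hE.
Qed.

Let k20 : 0 < 2 * k ^+ 2 :> R. Proof. by rewrite mulr_gt0// exprn_gt0. Qed.

Let normsq_neq0 n x : 0 < rho n x ->
  vprod ((g n) ^~ x) ((h n) ^~ x) 0 ^+ 2 + vprod ((g n) ^~ x) ((h n) ^~ x) 1 ^+ 2 + vprod ((g n) ^~ x) ((h n) ^~ x) 2 ^+ 2 != 0.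
Proof. by move=> x0; rewrite (normsq x0) gt_eqF. Qed.

(** The shell index comes from choice and is unique by [rho_disj]. The identity matrix elsewhere
    keeps the determinant equal to 1. *)
Definition sel_field (x : R3 R) : 'M[R]_3 :=
  if pselect (exists n, 0 < rho n x) is left H then
    Pmat ((g (projT1 (cid H))) ^~ x) ((h (projT1 (cid H))) ^~ x)
  else 1%:M.

Lemma sel_fieldE n x : 0 < rho n x -> sel_field x = Pmat ((g n) ^~ x) ((h n) ^~ x).
Proof.
move=> x0; rewrite /sel_field; case: pselect => [H|nH]; last by exfalso; apply: nH; exists n.
by case: (cid H) => m m0 /=; rewrite (rho_disj x0 m0).
Qed.

Lemma sel_field_out x : (forall n, ~ 0 < rho n x) -> sel_field x = 1%:M.
Proof. by move=> nx; rewrite /sel_field; case: pselect => // H; exfalso; case: H => n /nx. Qed.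

Lemma det_sel_field x : \det (sel_field x) = 1.
Proof.
have [[n x0]|nx] := pselect (exists n, 0 < rho n x).
  by rewrite (sel_fieldE x0) det_Pmat// (normsq_neq0 x0).
by rewrite sel_field_out ?det1// => n x0; apply: nx; exists n.
Qed.

Lemma measurable_sel_field i j : measurable_fun setT (fun x => sel_field x i j).
Proof.
pose n n' x := vprod ((g n') ^~ x) ((h n') ^~ x).
(* The denominator is replaced by its constant value on the shell, so these functions are polynomial
   in the gradients and measurable everywhere. *)
pose f_ n' x := if j == 0 then vprod ((g n') ^~ x) (n n' x) i / (2 * k ^+ 2)
  else if j == 1 then vprod ((h n') ^~ x) (n n' x) i / (2 * k ^+ 2) else n n' x i.
apply: (measurable_select (E := fun n => [set x | 0 < rho n x])
  (f_ := f_) (c := (1%:M : 'M[R]_3) i j)) => //.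
- move=> n'.
  have mv (u v : 'I_3 -> R3 R -> R) : (forall j, measurable_fun setT (u j)) ->
      (forall j, measurable_fun setT (v j)) ->
      forall j, measurable_fun setT (fun x => vprod (u ^~ x) (v ^~ x) j).
    by move=> mu mv j'; apply: measurable_funB; apply: measurable_funM.
  have mn := mv (g n') (h n') (mg n') (mh n').
  have mgn := mv (g n') _ (mg n') mn; have mhn := mv (h n') _ (mh n') mn.
  rewrite /f_; case: (j == 0); last case: (j == 1).
  + by apply: measurable_funM; [exact: mgn|exact: measurable_cst].
  + by apply: measurable_funM; [exact: mhn|exact: measurable_cst].
  + exact: mn.
- by move=> n' x x0; rewrite (sel_fieldE x0) mxE (normsq x0).
- by move=> x nx; rewrite sel_field_out.
Qed.

Lemma sel_field_bounded : exists C, forall x i j, `|sel_field x i j| <= C.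
Proof.
have H0 : 0 <= 2 + k by have := ltW k0; lra.
pose V := 2 * (2 + k); have V0 : 0 <= V by rewrite mulr_ge0.
have NK : 0 < (2 * k ^+ 2)^-1 by rewrite invr_gt0.
pose C := 1 + V + (2 * (2 + k) * V) * (2 * k ^+ 2)^-1.
have T0 : 0 <= (2 * (2 + k) * V) * (2 * k ^+ 2)^-1 by rewrite !mulr_ge0// ltW.
exists C => x i j; have [[n x0]|nx] := pselect (exists n, 0 < rho n x); last first.
  rewrite sel_field_out; last by move=> n x0; apply: nx; exists n.
  rewrite mxE; apply: (@le_trans _ _ 1); last by rewrite /C -addrA lerDl addr_ge0.
  by case: (i == j); rewrite ?normr1 ?normr0.
rewrite (sel_fieldE x0) mxE (normsq x0).
have vle c (H : forall j, `|c j| <= 2 + k) l :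
    `|vprod c (vprod ((g n) ^~ x) ((h n) ^~ x)) l / (2 * k ^+ 2)| <= C.
  apply: (@le_trans _ _ ((2 * (2 + k) * V) * (2 * k ^+ 2)^-1)); last by rewrite /C lerDr addr_ge0.
  rewrite normrM (gtr0_norm NK) ler_wpM2r ?(ltW NK)// /vprod (le_trans (ler_normB _ _))// !normrM.
  have K (i' j' : 'I_3) : `|c i'| * `|vprod ((g n) ^~ x) ((h n) ^~ x) j'| <= (2 + k) * V.
    by rewrite ler_pM// vprod_le.
  by have := K (l + 1) (l + 2); have := K (l + 2) (l + 1); rewrite /vprod; lra.
case: ifP => _; last case: ifP => _.
- by apply: vle => l; rewrite (le_trans (g_le1 l x0))//; have := ltW k0; lra.
- by apply: vle => l; exact: h_le.
- apply: le_trans (vprod_le i x0) _.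
  by rewrite -/V /C -addrA [leRHS]addrCA lerDl addr_ge0.
Qed.

Let G0 n x : 'M[R]_3 := grad_mat ((g n) ^~ x) ((h n) ^~ x).
Let I n : \bar R := (\int[leb3]_(x in Om) (Lq_density q (G0 n) x)%:E)%E.

Let mG0 n : measurable_field Om (G0 n).
Proof.
move=> i j; apply: measurable_funTS; under eq_fun do rewrite mxE.
case: (i == 0); first exact: mg.
by case: (i == 1); [exact: mh|exact: measurable_cst].
Qed.

Let G0_bounded n : exists C, forall x i j, `|G0 n x i j| <= C.
Proof.
have [[_ _ [C C0 gC] _] [_ _ [D D0 hD] _] _ _ _] := FP' n.
exists (C + D) => x i j; rewrite mxE; case: ifP => _; last case: ifP => _.
- by rewrite (le_trans (gC j x))// lerDl.
- by rewrite (le_trans (hD j x))// lerDr.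
- by rewrite normr0 addr_ge0.
Qed.

Let I_lty n : (I n < +oo)%E.
Proof.
have [C GC] := G0_bounded n; have := Lq_norm_lty q1 mOm fOm (mG0 n) GC.
by apply: lty_poweRy; rewrite invr_eq0 gt_eqF// (lt_trans ltr01).
Qed.

(** On the shell the first row is a unit vector, so the density is at least 1 there; [r <= a n] then
    bounds the volume of the shell from below. *)
Let I_ge n : (((b n - a n) * (4 * r ^+ 2))%:E <= I n)%E.
Proof.
have a0 : 0 < a n := lt_le_trans r0 (a_ge n).
apply: (@le_trans _ _ (leb3 [set x | (0 < rho n x)%R])).
  apply: le_trans (leb3_shell_ge q1 mOm fOm p a0 (ab n)).
  have a2 : r ^+ 2 <= a n ^+ 2 by rewrite ler_sqr ?nnegrE ?(ltW r0) ?(ltW a0).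
  by rewrite lee_fin ler_pM2l ?subr_gt0// exprMn; have := a2; lra.
have -> : [set x | 0 < rho n x] = [set x | 0 < rho n x] `&` Om.
  by apply/seteqP; split => [x x0|x []//]; split => //; exact: rho_Om x0.
rewrite -integral_indic//; apply: ge0_le_integral => //.
- by apply/measurable_EFinP; apply: measurable_funTS; exact: measurable_indic.
- by apply/measurable_EFinP; exact: measurable_Lq_density.
- move=> x Ox; rewrite lee_fin indicE; case: (boolP (x \in _)) => [/set_mem /= x0|_]; last first.
    exact: Lq_density_ge0.
  rewrite /Lq_density (bigD1 0)//= [leLHS](_ : _ = 1)//.
  have -> : enorm (row 0 (G0 n x)) = 1.
    have [_ _ _ _ /(_ x Ox x0)[[i [s [s1 gE]]] _]] := FP' n.
    rewrite enorm_row !mxE /= !gE.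
    rewrite (_ : _ + _ + _ = 1) ?sqrtr1//.
    by case: i {gE} => [[|[|[|//]]] ?]; rewrite -?val_eqE /=; case: s1 => ->; ring.
  by rewrite powR1 lerDl; apply: sumr_ge0 => i _; exact: powR_ge0.
Qed.

Let d n : R := b n - a n.
Let d0 n : 0 < d n. Proof. by rewrite subr_gt0. Qed.
Let Ir n : R := fine (I n).
Let IE n : I n = (Ir n)%:E.
Proof.
rewrite fineK// ge0_fin_numE//; apply: integral_ge0 => x _.
by rewrite lee_fin Lq_density_ge0.
Qed.
Let Ir_ge n : d n * (4 * r ^+ 2) <= Ir n.
Proof. by have := I_ge n; rewrite IE lee_fin. Qed.
Let r20 : 0 < 4 * r ^+ 2. Proof. by rewrite mulr_gt0// exprn_gt0. Qed.
Let Ir_gt0 n : 0 < Ir n.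
Proof. by apply: lt_le_trans (Ir_ge n); rewrite mulr_gt0. Qed.
(** Solves [c^q * Ir = 2], the normalization of the gradient norm. *)
Let c n : R := (2 / Ir n) `^ q^-1.
Let c0 n : 0 < c n. Proof. by rewrite powR_gt0// divr_gt0. Qed.
Let q0 : 0 < q. Proof. exact: lt_trans ltr01 q1. Qed.

Let U n (i : 'I_3) x : R := c n * (if i == 0 then rho n x else if i == 1 then w n x else 0).
Let DU n (i j : 'I_3) x : R := c n * (if i == 0 then g n j x else if i == 1 then h n j x else 0).

Definition fold_map n x : 'rV[R]_3 := \row_i U n i x.
Definition fold_grad n x : 'M[R]_3 := \matrix_(i, j) DU n i j x.

Let fold_gradE n x : fold_grad n x = c n *: G0 n x.
Proof. by apply/matrixP => i j; rewrite !mxE. Qed.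

Let rho_ge0 n x : 0 <= rho n x. Proof. exact: shell_fun_ge0. Qed.
Let rho_le n x : rho n x <= d n. Proof. exact: shell_fun_le (ltW (ab n)). Qed.

Let U_ge0 n i x : 0 <= U n i x.
Proof.
have [_ _ /(_ x)/andP[rw _] _ _] := FP' n.
rewrite mulr_ge0 ?(ltW (c0 n))//; case: ifP => _ //; case: ifP => _ //.
exact: le_trans (rho_ge0 n x) rw.
Qed.

Let U_le n i x : U n i x <= c n * (2 * d n).
Proof.
have [_ _ /(_ x)/andP[_ wr] _ _] := FP' n.
have dl := rho_le n x; have dn := d0 n.
rewrite ler_pM2l//; case: ifP => _; last case: ifP => _; lra.
Qed.

Lemma fold_map_W1q0 n : in_W1q0 q Om (fold_map n) (fold_grad n).
Proof.
have [Sr Sw rw gh0 _] := FP' n.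
apply: (Sob_in_W1q0 q1 mOm fOm (K := closed_cube p (2 * r)) (B := c n * (2 * d n))).
- move=> i; apply: (Sob_scale mOm fOm).
  case: (i == 0); first exact: Sr.
  by case: (i == 1); [exact: Sw|exact: Sob_cst].
- exact: closed_cube_compact.
- exact: cubeOm.
- move=> i x; rewrite pmulr_rgt0//; have /andP[rw1 rw2] := rw x.
  case: ifP => _; first exact: rho_cube.
  case: ifP => _; last by rewrite ltxx.
  by move=> w0; apply: (@rho_cube n); lra.
- exact: U_ge0.
- exact: U_le.
(* Inside the shell [w >= rho > 0], so there only the third component, which is identically zero,
   satisfies [U <= 0]. *)
- move=> i x U0 j.
  have [x0|x0] := leP (rho n x) 0.
    have [gx hx] := gh0 x x0 j; rewrite /DU gx hx.
    by case: ifP => _; last case: ifP => _; rewrite mulr0.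
  have /andP[rw1 _] := rw x; move: U0; rewrite /U /DU pmulr_rle0//.
  case: ifP => _; first by rewrite leNgt x0.
  case: ifP => _; last by rewrite mulr0.
  by rewrite leNgt (lt_le_trans x0 rw1).
Qed.

(** Outside its own shell the gradient is zero, so whatever the other shells prescribe for
    [sel_field] is harmless. *)
Lemma fold_grad_skew n x : Om x ->
  fold_grad n x *m sel_field x + (fold_grad n x *m sel_field x)^T = 0.
Proof.
move=> Ox; rewrite fold_gradE -scalemxAl linearZ /= -scalerDr.
have [x0|x0] := ltP 0 (rho n x).
  by rewrite (sel_fieldE x0) grad_mat_Pmat_skew ?(normsq_neq0 x0)// scaler0.
have [_ _ _ gh0 _] := FP' n.
have -> : G0 n x = 0.
  apply/matrixP => i j; have [gx hx] := gh0 x x0 j; rewrite !mxE gx hx.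
  by case: ifP => _ //; case: ifP.
by rewrite mul0mx trmx0 addr0 scaler0.
Qed.

Lemma Lq_norm_fold_grad n : Lq_norm q Om (fold_grad n) = (2 `^ q^-1)%:E.
Proof.
have dens x : Lq_density q (fold_grad n) x = c n `^ q * Lq_density q (G0 n) x.
  rewrite /Lq_density mulr_sumr; apply: eq_bigr => i _.
  by rewrite fold_gradE enorm_rowZ ?(ltW (c0 n))// powRM ?sqrtr_ge0// ltW.
have cq : c n `^ q = 2 / Ir n.
  by rewrite /c -powRrM mulVf ?gt_eqF// powRr1// ltW// divr_gt0.
rewrite /Lq_norm -poweR_EFin; congr (_ `^ _)%E.
transitivity (\int[leb3]_(x in Om) ((c n `^ q)%:E * (Lq_density q (G0 n) x)%:E))%E.
  by apply: eq_integral => x _; rewrite -EFinM -dens.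
rewrite ge0_integralZl_EFin ?powR_ge0//; last 2 first.
- by move=> x _; rewrite lee_fin Lq_density_ge0.
- by apply/measurable_EFinP; exact: measurable_Lq_density.
by rewrite -/(I n) IE -EFinM cq divfK// gt_eqF.
Qed.

Let mfold_map n : measurable_field Om (fold_map n).
Proof. by have [[[]]] := fold_map_W1q0 n. Qed.

Let Om_gt0 : (0 < leb3 Om)%E.
Proof.
have a00 : 0 < a 0 := lt_le_trans r0 (a_ge 0).
apply: (@lt_le_trans _ _ (leb3 [set x | (0 < rho 0 x)%R])).
  apply: lt_le_trans (leb3_shell_ge q1 mOm fOm p a00 (ab 0)).
  rewrite lte_fin; apply: mulr_gt0; first by rewrite subr_gt0.
  by apply: exprn_gt0; exact: mulr_gt0.
by apply: le_measure; rewrite ?inE//; move=> x; exact: rho_Om.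
Qed.

Let enorm_fold_map n x : enorm (fold_map n x) <= 6 * (c n * d n).
Proof.
have -> : fold_map n x = row 0 (fold_map n x) by apply/rowP => j; rewrite !mxE.
apply: le_trans (enorm_row_le _ _) _; rewrite !mxE !ger0_norm ?U_ge0//.
by have := U_le n 0 x; have := U_le n 1 x; have := U_le n 2 x; lra.
Qed.

Let Linfty_fold_map n : (0 <= Linfty_norm Om (fold_map n))%E /\
  (Linfty_norm Om (fold_map n) <= (6 * (c n * d n))%:E)%E.
Proof.
apply: Linfty_norm_bounds => //.
by rewrite mulr_ge0// mulr_ge0// ltW.
Qed.

Lemma fold_map_Linfty n : in_Linfty Om (fold_map n).
Proof. by split => //; apply: le_lt_trans (Linfty_fold_map n).2 (ltry _). Qed.

Lemma sel_field_Linfty : in_Linfty Om sel_field.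
Proof.
split; first by move=> i j; apply: measurable_funTS; exact: measurable_sel_field.
have [C HC] := sel_field_bounded.
have [_ H] := Linfty_norm_bounds Om_gt0 mOm (sqrtr_ge0 _) (fun x _ => enorm_le (HC x)).
exact: le_lt_trans H (ltry _).
Qed.

Lemma Linfty_fold_map_cvg : (fun n => Linfty_norm Om (fold_map n)) @ \oo --> 0%E.
Proof.
pose s := q^-1; have s0 : 0 < s by rewrite invr_gt0.
have s1 : 0 < 1 - s by rewrite subr_gt0 invf_lt1.
(* [Ir_ge] gives [2 / Ir n <= A / d n], hence [c n <= (A / d n)^s]; multiplying by [d n] leaves the
   positive power [1 - s]. *)
pose A : R := 2 / (4 * r ^+ 2); have A0 : 0 < A by rewrite divr_gt0.
have cd n : c n * d n <= A `^ s * d n `^ (1 - s).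
  have -> : A `^ s = (A / d n) `^ s * d n `^ s.
    by rewrite -powRM ?divfK ?gt_eqF ?(ltW (d0 n))// ltW// divr_gt0.
  rewrite -mulrA -powRD; last by apply/implyP => _; rewrite gt_eqF.
  rewrite (_ : s + (1 - s) = 1); last ring.
  rewrite powRr1 ?(ltW (d0 n))// ler_pM2r// ge0_ler_powR ?nnegrE ?(ltW s0)//.
  - by rewrite ltW// divr_gt0.
  - by rewrite ltW// divr_gt0.
  - rewrite /A -mulrA ler_pM2l// -invfM lef_pV2 ?posrE ?mulr_gt0//.
    by rewrite mulrC.
(* The thickness is geometric with ratio 1/2, so its power [1 - s] is geometric with ratio
   [y < 1]. *)
pose y : R := 2^-1 `^ (1 - s).
have y0 : 0 <= y by exact: powR_ge0.
have y1 : y < 1.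
  have e1 : 1 `^ (1 - s) = 1 :> R by rewrite powR1.
  rewrite /y -[ltRHS]e1; apply: gt0_ltr_powR; rewrite ?nnegrE//.
  by rewrite invf_lt1// ltr1n.
have dE n : d n `^ (1 - s) = r `^ (1 - s) * y ^+ n.+1.
  rewrite /d baE powRM ?(ltW r0) ?(ltW (half_gt0 _))//; congr (_ * _).
  by rewrite /half -powR_mulrn ?invr_ge0// powRAC powR_mulrn.
apply: (@squeeze_cvge _ _ _ _ (cst 0%E) _
  (fun n => (6 * (A `^ s * (r `^ (1 - s) * y ^+ n.+1)))%:E)).
- apply: nearW => n; have [-> /= H] := Linfty_fold_map n; apply: le_trans H _.
  by rewrite lee_fin ler_pM2l// -dE.
- exact: cvg_cst.
- apply: cvg_EFin; first exact: nearW.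
  rewrite -[X in _ --> X](mulr0 6); apply: cvgM; first exact: cvg_cst.
  rewrite -[X in _ --> X](mulr0 (A `^ s)); apply: cvgM; first exact: cvg_cst.
  rewrite -[X in _ --> X](mulr0 (r `^ (1 - s))); apply: cvgM; first exact: cvg_cst.
  have : (fun n => y ^+ n) @ \oo --> (0 : R) by apply: cvg_expr; rewrite ger0_norm.
  by rewrite -(cvg_shiftS (fun n => y ^+ n)).
Qed.
End assembly.

Unset Implicit Arguments.
Theorem theorem1 (R : realType) (q : R) (hq : 1 < q) (Om : set (R3 R))
    (Om_neq0 : Om !=set0) (Om_open : open Om) (Om_bounded : bounded_set Om) :
  exists (P : R3 R -> 'M[R]_3) (u : nat -> R3 R -> 'rV[R]_3)
         (Du : nat -> R3 R -> 'M[R]_3),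
    in_Linfty Om P /\
    {ae leb3, forall x, Om x -> \det (P x) = 1} /\
    (forall n, in_W1q0 q Om (u n) (Du n)) /\
    (forall n, in_Linfty Om (u n)) /\
    (forall n, {ae leb3, forall x, Om x ->
       Du n x *m P x + (Du n x *m P x)^T = 0}) /\
    (forall n, Lq_norm q Om (Du n) = (2 `^ q^-1)%:E) /\
    (fun n => Linfty_norm Om (u n)) @ \oo --> 0%:E.

Proof.
have mOm : measurable Om := open_measurable3 Om_open.
have [M M0 HM] : exists2 M, 0 < M & forall x i, Om x -> `|crd i x| <= M.
  case: Om_bounded => M [_ HM]; exists (`|M| + 1) => [|x i Ox]; first by rewrite ltr_wpDl.
  apply: le_trans (crd_le_norm i x) (HM _ _ x Ox).
  by rewrite (le_lt_trans (ler_norm M))// ltrDl.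
have fOm : (leb3 Om < +oo)%E.
  apply: le_lt_trans (leb3_cube_lty M); apply: le_measure; rewrite ?inE//.
    by do 2! [apply: measurableX => //]; exact: measurable_itv.
  move=> x Ox; have := HM x 0 Ox; have := HM x 1 Ox; have := HM x 2 Ox.
  rewrite /crd /= !ler_norml => h2 h1 h0.
  by split; [split|]; rewrite /= in_itv/=.
have [p Omp] := Om_neq0.
have : nbhs p Om by apply: open_nbhs_nbhs.
rewrite -nbhs_ballE => -[e /= e0 peOm].
(* With [r = e / 3] the closed cube of radius [2 * r < e] fits into the ball around [p]. *)
have r0 : 0 < e / 3 by rewrite divr_gt0.
have cubeOm : closed_cube p (2 * (e / 3)) `<=` Om.
  apply: subset_trans peOm; apply: closed_cube_ball; lra.
have [v0 [g0 [k [Sv v00 v01 k0 gk]]]] := Sob_clip hq mOm fOm M0 HM.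
have /choice[F FP] := fun n : nat => shell_data_exists p
  (e / 3 * (1 + 2^-1 ^+ n.+1)) (e / 3 * (1 + 2^-1 ^+ n)) hq mOm fOm Sv v00 v01 gk.
exists (sel_field p (e / 3) F), (fold_map q Om p (e / 3) F), (fold_grad q Om F).
split; first exact: (sel_field_Linfty hq mOm fOm k0 r0 cubeOm FP).
split; first by apply: aeW => x _; exact: (det_sel_field k0 r0 cubeOm FP).
split; first by move=> n; exact: (fold_map_W1q0 hq mOm fOm r0 cubeOm FP).
split; first by move=> n; exact: (fold_map_Linfty hq mOm fOm r0 cubeOm FP).
split; first by move=> n; apply: aeW => x Ox; exact: (fold_grad_skew k0 r0 cubeOm FP).
split; first by move=> n; exact: (Lq_norm_fold_grad hq mOm fOm r0 cubeOm FP).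
exact: (Linfty_fold_map_cvg hq mOm fOm r0 cubeOm FP).
Qed.
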